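(* Let $G$ be a unicyclic graph with $n \geq 3$ vertices and independence number $\alpha$. Then \[ mis(G)\geq \begin{cases} 2, & \text{if } n=4 \text{ and } \alpha=2,\\ 3, & \text{if } \alpha=n-2 \text{ and } n\neq 4,\\ 2f(n-\alpha), & \text{if } n\geq 5 \text{ and } \lceil n/2 \rceil \leq \alpha < n-2,\\ f(n-\alpha+2)-f(n-\alpha-3), & \text{if } n\geq 5,\ n \text{ is odd, and } \alpha=\lfloor n/2\rfloor. \end{cases} \] Moreover, this inequality is sharp: for every pair $(n,\alpha)$ falling into one of the four cases above, there exists a unicyclic graph with $n$ vertices and independence number $\alpha$ attaining the corresponding bound with equality.
   Context: All graphs are simple and finite. A unicyclic graph is a connected graph containing exactly one cycle. An independent set of a graph $G$ is a set of pairwise non-adjacent vertices; a maximal independent set is an independent set not properly contained in another independent set. $mis(G)$ denotes the number of maximal independent sets of $G$, and the independence number $\alpha(G)$ is the maximum size of an independent set. $f(n)$ denotes the $n$th Fibonacci number: $f(0)=0$, $f(1)=1$, and $f(n)=f(n-1)+f(n-2)$ for $n\geq 2$. *)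

(* Defs.v *)
From mathcomp Require Import all_boot.

Set Implicit Arguments.
Unset Strict Implicit.
Unset Printing Implicit Defensive.

Record sgraph := SGraph {
  vertex :> finType;
  adj : rel vertex;
  adj_sym : symmetric adj;
  adj_irr : irreflexive adj }.

Definition connected (G : sgraph) : Prop := forall x y : G, connect (@adj G) x y.

(* A cycle is a subgraph, identified with its set of edges, so that it does not
   depend on the starting vertex or on the direction in which it is listed.
   The size condition excludes the back-and-forth walk along a single edge. *)
Definition is_cycle (G : sgraph) (C : {set {set G}}) : Prop :=
  exists c : seq G,
    [/\ 2 < size c, ucycle (@adj G) c & C = [set [set x; next c x] | x in c]].

Definition unicyclic (G : sgraph) : Prop :=
  connected G /\ exists! C : {set {set G}}, is_cycle C.

Definition independent (G : sgraph) (S : {set G}) : bool :=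
  [forall x in S, forall y in S, ~~ adj x y].

Definition indep_num (G : sgraph) : nat :=
  \max_(S : {set G} | independent S) #|S|.

Definition mis (G : sgraph) : nat :=
  #|[set S : {set G} | maxset (@independent G) S]|.

Fixpoint fib (n : nat) : nat :=
  match n with
  | 0 => 0
  | 1 => 1
  | (m.+1 as p).+1 => fib p + fib m
  end.

(* The four guards are mutually exclusive for n >= 3, and all the subtractions
   are then exact; None means that (n, a) falls into none of the cases. *)
Definition mis_bound (n a : nat) : option nat :=
  if (n == 4) && (a == 2) then Some 2
  else if (a == n - 2) && (n != 4) then Some 3
  else if [&& 5 <= n, uphalf n <= a & a < n - 2] then Some (2 * fib (n - a))
  else if [&& 5 <= n, odd n & a == n./2] then
    Some (fib (n - a + 2) - fib (n - a - 3))
  else None.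

(* Main.v *)
(** Write tau = n - alpha for the vertex cover number.  If l is a leaf at u, a
    maximal independent set contains exactly one of l and u, so
    mis(A) = mis(A - N[l]) + mis(A - N[u]).  If moreover u has at most one
    non-leaf neighbour, the two parts lose at most 1 and 2 from tau: this gives
    mis >= f(tau + 2) for forests and, by the same induction, mis >= 2 f(tau)
    for graphs with a single cycle C.  If C is not a 4-cycle the induction
    starts from a better value and gives mis >= f(s + 2) - f(s - 3), with
    s = tau(C) + tau(G - C).  When n = 2 tau - 1, s equals tau and C is odd.

    Extremal graphs are a triangle with leaves at one vertex, C_5, and C_4 or
    C_7 with a path hanging at one vertex, each vertex of which carries a leaf;
    their invariants satisfy linear recurrences under the addition of a leaf. *)

Require Import Defs.
From mathcomp Require Import all_boot zify.

Set Implicit Arguments.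
Unset Strict Implicit.
Unset Printing Implicit Defensive.

(** * Maximal independent sets and covers of induced subgraphs *)

(** The deletions leave disconnected induced subgraphs, so every invariant is attached to a vertex
    set [A] of one fixed graph and the inductions run on [#|A|]. The cycle is replaced by a
    condition on vertex sets, [one_core], under which each [A] either contains [C] or is a forest.
    The odd bound cannot be proved with [tau A] in place of [s]: a triangle with one leaf at each
    vertex has [tau] 3 but only 4 maximal independent sets, while [odd_bound 3] is 5. The sum [s]
    ignores the edges between [C] and the rest, and still loses at most 1 and 2 at leaves away from
    [C]. Excluding the 4-cycle is forced too: C_4 has 2 maximal independent sets, and [odd_bound 2]
    is 3. *)

Lemma fibSS n : fib n.+2 = fib n.+1 + fib n.
Proof. by []. Qed.

Lemma leq_fib : {homo fib : m n / m <= n}.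
Proof.
apply: homo_leq => // [m n p|[|n]] //; first exact: leq_trans.
by rewrite fibSS leq_addr.
Qed.

(** Truncated subtraction makes this [fib (s + 2)] for [s <= 3]. The values start 1, 2, 3, 5, 7, 12;
    the Fibonacci recurrence fails only at 7. *)
Definition odd_bound s := fib (s + 2) - fib (s - 3).

(** The form in which the bound arises on a cycle: [fib s] from each end of an edge, and
    [fib (s - 2)] from sets avoiding both ends. *)
Lemma odd_boundE s : odd_bound s.+3 = 2 * fib s.+3 + fib s.+1.
Proof.
rewrite /odd_bound addn2 !subSS subn0 !fibSS; lia.
Qed.

Lemma leq_odd_bound : {homo odd_bound : m n / m <= n}.
Proof.
apply: homo_leq => // [m n p|[|[|[|n]]]] //; first exact: leq_trans.
by rewrite !odd_boundE leq_add ?leq_mul //; apply: leq_fib.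
Qed.

Lemma odd_bound_rec s : odd_bound s.+4.+1 = odd_bound s.+4 + odd_bound s.+3.
Proof. rewrite !odd_boundE !fibSS; lia. Qed.

Lemma odd_bound_subadd s : odd_bound s.+3 <= odd_bound s.+2 + odd_bound s.+1.
Proof. by case: s => [|[|s]] //; rewrite odd_bound_rec. Qed.

Lemma odd_bound_le_fib s : odd_bound s <= fib s.+2.
Proof. by rewrite /odd_bound addn2 leq_subr. Qed.

(** Here [p], [q], [r] stand for the cover numbers left by the three deletions on the cycle. At
    [s = 2] the term [fib (s - 2)] vanishes and [0 < m] supplies the missing 1. *)
Lemma odd_bound_edge s p q r m : 1 < s -> s <= p + 2 -> s <= q + 2 ->
  s <= r + 4 -> fib (r + 2) <= m -> 0 < m ->
  odd_bound s <= fib (p + 2) + fib (q + 2) + m.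
Proof.
move=> s1 /leq_fib hp /leq_fib hq hr hm m0.
apply: leq_trans (_ : fib s + fib s + m <= _); last by rewrite leq_add2r leq_add.
case: s s1 hr {hp hq} => [|[|[|s]]] // _ hr.
rewrite odd_boundE mul2n -addnn leq_add2l; apply: leq_trans hm.
by apply: leq_fib; lia.
Qed.

Section Graph.
Variable G : sgraph.
Implicit Types (A B C I J K S X Y : {set G}) (u v w x y : G).

Let adjC : symmetric (@adj G) := @adj_sym G.
Let adjxx : irreflexive (@adj G) := @adj_irr G.

Lemma independentP S :
  reflect {in S &, forall x y, ~~ adj x y} (independent S).
Proof.
apply: (iffP forall_inP) => [h x y xS yS|h x xS].
  by move/forall_inP: (h x xS); apply.
by apply/forall_inP => y yS; apply: h.
Qed.

Lemma independentS S S' : S \subset S' -> independent S' -> independent S.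
Proof.
move=> /subsetP sub /independentP h; apply/independentP => x y /sub xS /sub yS.
exact: h.
Qed.

Lemma independent0 : independent (set0 : {set G}).
Proof. by apply/independentP => x y; rewrite inE. Qed.

Lemma independent1 u : independent [set u].
Proof. by apply/independentP => x y /set1P -> /set1P ->; rewrite adjxx. Qed.

Lemma independentU S S' : independent S -> independent S' ->
  (forall x y, x \in S -> y \in S' -> ~~ adj x y) -> independent (S :|: S').
Proof.
move=> /independentP iS /independentP iS' h.
apply/independentP => x y /setUP[] xS /setUP[] yS; first exact: iS.
- exact: h.
- by rewrite adjC; apply: h.
- exact: iS'.
Qed.

Definition alpha A := \max_(S : {set G} | (S \subset A) && independent S) #|S|.
Definition tau A := #|A| - alpha A.

Lemma leq_alpha A S : S \subset A -> independent S -> #|S| <= alpha A.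
Proof.
move=> sSA iS; apply: (leq_bigmax_cond (F := fun S => #|pred_of_set S|)).
by rewrite sSA.
Qed.

Lemma alpha_witness A :
  exists S, [/\ S \subset A, independent S & #|S| = alpha A].
Proof.
have [|S /andP[sSA iS] eS] := @eq_bigmax_cond _
  [pred S : {set G} | (S \subset A) && independent S] (fun S => #|pred_of_set S|).
  by apply/card_gt0P; exists set0; rewrite inE sub0set independent0.
by exists S; split.
Qed.

Lemma alpha_le A : alpha A <= #|A|.
Proof. by have [S [sSA _ <-]] := alpha_witness A; apply: subset_leq_card. Qed.

Lemma tau_alpha A : tau A + alpha A = #|A|.
Proof. by rewrite subnK ?alpha_le. Qed.

Lemma tau_cover A K : independent (A :\: K) -> tau A <= #|K|.
Proof.
move=> /(leq_alpha (subsetDl _ _)); rewrite cardsD => h.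
have := tau_alpha A; have := subset_leq_card (subsetIr A K); lia.
Qed.

Lemma tau_witness A :
  exists K, [/\ K \subset A, independent (A :\: K) & #|K| = tau A].
Proof.
have [S [sSA iS eS]] := alpha_witness A; exists (A :\: S); split.
- exact: subsetDl.
- by apply: independentS iS; rewrite setDDr setDv set0U subsetIr.
- by rewrite cardsDS // eS.
Qed.

Lemma leq_tau A B : A \subset B -> tau A <= tau B.
Proof.
move=> sAB; have [K [_ iK <-]] := tau_witness B.
by apply: tau_cover; apply: independentS iK; apply: setSD.
Qed.

Lemma tau_add A B : B \subset A -> tau B + tau (A :\: B) <= tau A.
Proof.
move=> sBA; have [K [_ iK <-]] := tau_witness A.
rewrite -(cardsID B K) leq_add //; apply: tau_cover.
  apply: independentS iK; apply/subsetP => x; rewrite !inE => /andP[h xB].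
  by rewrite (subsetP sBA) // andbT; move: h; rewrite xB andbT.
apply: independentS iK; apply/subsetP => x; rewrite !inE.
by case: (x \in B); case: (x \in K).
Qed.

Lemma tau_subadd A B : tau A <= #|B| + tau (A :\: B).
Proof.
have [K [_ iK <-]] := tau_witness (A :\: B).
apply: leq_trans (_ : #|B :|: K| <= _); last by rewrite cardsU leq_subr.
by apply: tau_cover; rewrite -setDDl.
Qed.

(** Adding [Y] to a cover of [A :\: X] covers [A]. Most losses of [tau] are bounded below by
    exhibiting such a [Y]. *)
Lemma tau_del A X Y :
    (forall x y, x \in A -> y \in A -> x \in X -> adj x y ->
      (x \in Y) || (y \in Y)) ->
  tau A <= tau (A :\: X) + #|Y|.
Proof.
move=> h; have [K [_ iK <-]] := tau_witness (A :\: X).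
apply: leq_trans (_ : #|K :|: Y| <= _); last by rewrite cardsU leq_subr.
apply: tau_cover; apply/independentP => x y.
rewrite !inE !negb_or -!andbA => /and3P[xK xY xA] /and3P[yK yY yA].
apply/negP => axy.
have [xX|xX] := boolP (x \in X).
  by have := h x y xA yA xX axy; rewrite (negPf xY) (negPf yY).
have [yX|yX] := boolP (y \in X).
  by rewrite adjC in axy; have := h y x yA xA yX axy; rewrite (negPf xY) (negPf yY).
move/independentP/(_ x y): iK; rewrite !inE xX yX xK yK xA yA axy.
by move=> /(_ isT isT).
Qed.

Definition clN S := [set y | [exists x in S, (x == y) || adj x y]].

Lemma clNP S y :
  reflect (exists2 x, x \in S & (x = y) \/ adj x y) (y \in clN S).
Proof.
rewrite inE; apply: (iffP exists_inP) => [[x xS /orP[/eqP|]]|[x xS [<-|h]]].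
- by exists x; [|left].
- by exists x; [|right].
- by exists x; rewrite ?eqxx.
- by exists x; rewrite ?h ?orbT.
Qed.

Lemma in_clN1 u y : (y \in clN [set u]) = (y == u) || adj u y.
Proof.
apply/clNP/orP => [[x /set1P ->] [->|]|[/eqP->|]]; rewrite ?eqxx; try by [left|right].
  by exists u; [apply/set1P|left].
by move=> h; exists u; [apply/set1P|right].
Qed.

(** Maximality is expressed as domination inside [A], so that the induced subgraph never has to be
    formed. *)
Definition mises A := [set S : {set G} | [&& S \subset A, independent S &
  [forall x in A :\: S, [exists y in S, adj x y]]]].

Definition misA A := #|mises A|.

Lemma misesP A S : reflect [/\ S \subset A, independent S &
  forall x, x \in A -> x \notin S -> exists2 y, y \in S & adj x y]
  (S \in mises A).
Proof.
rewrite inE; apply: (iffP and3P) => -[sSA iS h]; split=> //.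
  by move=> x xA xS; apply/exists_inP; apply: (forall_inP h); rewrite inE xS.
by apply/forall_inP => x /setDP[xA xS]; apply/exists_inP; apply: h.
Qed.

Lemma mises_maxset S : (S \in mises setT) = maxset (@independent G) S.
Proof.
apply/misesP/maxsetP => [[_ iS h]|[iS h]]; split=> //.
- move=> B iB sSB; apply/eqP; rewrite eqEsubset sSB andbT.
  apply/subsetP => x xB; apply/negPn/negP => xS.
  have [y /(subsetP sSB) yB] := h x (in_setT x) xS.
  by apply/negP; move/independentP: iB; apply.
- move=> x _ xS.
  have [/independentP n|] := boolP (independent (x |: S)).
    by move: xS; rewrite -{1}(h _ _ (subsetUr [set x] S)) ?setU11 //; apply/independentP.
  have [/exists_inP[y yS axy] _|no] := boolP [exists y in S, adj x y]; first by exists y.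
  case/negP; apply: independentU => //; first exact: independent1.
  move=> a b /set1P -> bS; apply: contra no => axb.
  by apply/exists_inP; exists b.
Qed.

Lemma misT : mis G = misA setT.
Proof. by apply: eq_card => S; rewrite mises_maxset inE. Qed.

Lemma alphaT : indep_num G = alpha setT.
Proof. by apply: eq_bigl => S; rewrite subsetT. Qed.

(** The map from [I] to [I :\: S] is a bijection: choosing [S] decides all of N[S], and the rest is
    maximal in what remains. *)
Lemma card_mises_sup A S : S \subset A -> independent S ->
  #|[set I in mises A | S \subset I]| = misA (A :\: clN S).
Proof.
move=> sSA iS.
have SN x : x \in S -> x \in clN S by move=> xS; apply/clNP; exists x; [|left].
have disj J : J \in mises (A :\: clN S) -> J = (J :|: S) :\: S.
  move=> /misesP[/subsetP sJ _ _]; apply/setP => x; rewrite !inE.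
  have [xS|] := boolP (x \in S); last by rewrite orbF.
  by apply/negP => /sJ; rewrite inE SN.
rewrite /misA -(@card_in_imset _ _ (fun J => J :|: S) (mises (A :\: clN S))); last first.
  by move=> J J' /disj eJ /disj eJ' e; rewrite eJ eJ' e.
apply: eq_card => I; rewrite inE; apply/andP/imsetP => [[]|[J /misesP[]]].
  move=> /misesP[/subsetP sIA iI h] sSI; exists (I :\: S); last first.
    apply/setP => x; rewrite !inE.
    by have [/(subsetP sSI) ->|] := boolP (x \in S); rewrite ?orbF.
  apply/misesP; split.
  - apply/subsetP => x /setDP[xI xS]; rewrite inE sIA // andbT.
    apply/negP => /clNP[y yS [e|ayx]]; first by rewrite -e yS in xS.
    by move/independentP/(_ y x (subsetP sSI _ yS) xI): iI; rewrite ayx.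
  - by apply: independentS iI; apply: subsetDl.
  - move=> x /setDP[xA xN]; rewrite inE => nx.
    have xS : x \notin S by apply: contra xN; apply: SN.
    have xI : x \notin I by move: nx; rewrite xS.
    have [y yI axy] := h x xA xI; exists y => //; rewrite inE yI andbT.
    by apply: contra xN => yS; apply/clNP; exists y; [|right; rewrite adjC].
move=> /subsetP sJ iJ h ->; rewrite subsetUr; split=> //; apply/misesP; split.
- by rewrite subUset sSA andbT; apply/subsetP => x /sJ /setDP[].
- apply: independentU => // x y /sJ /setDP[_ xN] yS; apply: contra xN => axy.
  by apply/clNP; exists y; [|right; rewrite adjC].
- move=> x xA; rewrite inE negb_or => /andP[xJ xS].
  have [/clNP[y yS [e|ayx]]|xN] := boolP (x \in clN S).
  + by rewrite -e yS in xS.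
  + by exists y; [rewrite inE yS orbT|rewrite adjC].
  + have [|y yJ axy] := h x _ xJ; first by rewrite inE xN.
    by exists y; rewrite ?inE ?yJ.
Qed.

Lemma card_mises_in A u : u \in A ->
  #|[set I in mises A | u \in I]| = misA (A :\: clN [set u]).
Proof.
move=> uA; rewrite -card_mises_sup ?sub1set ?independent1 //.
by apply: eq_card => I; rewrite !inE sub1set.
Qed.

Lemma clN_proper A u : u \in A -> #|A :\: clN [set u]| < #|A|.
Proof.
move=> uA; apply: proper_card; apply/properP; split; first exact: subsetDl.
by exists u; rewrite // in_setD in_clN1 eqxx.
Qed.
 
Lemma misA_gt0 A : 0 < misA A.
Proof.
elim: {A}_.+1 {-2}A (ltnSn #|A|) => // n IH A; rewrite ltnS => hn.
have [->|[u uA]] := set_0Vmem A.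
  apply/card_gt0P; exists set0; apply/misesP; rewrite sub0set independent0.
  by split=> // x; rewrite inE.
apply: leq_trans (IH (A :\: clN [set u]) (leq_trans (clN_proper uA) hn)) _.
rewrite -card_mises_in //; apply: subset_leq_card.
by apply/subsetP => I; rewrite inE => /andP[].
Qed.

End Graph.

(** * Lower bounds for forests and one-cycle graphs *)

Section LowerBound.
Variable G : sgraph.
Implicit Types (A B C D I J K S X Y : {set G}) (u v w x y l : G).

Let adjC : symmetric (@adj G) := @adj_sym G.
Let adjxx : irreflexive (@adj G) := @adj_irr G.

(** * Neighbourhoods, deletion recurrences and pendant vertices *)

Definition nb A x := [set y in A | adj x y].

Lemma in_nb A x y : (y \in nb A x) = (y \in A) && adj x y.
Proof. by rewrite inE. Qed.

Lemma nbS A B x : A \subset B -> nb A x \subset nb B x.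
Proof. by move=> sAB; apply/subsetP => y; rewrite !in_nb => /andP[/(subsetP sAB)->]. Qed.

Lemma nb_le1 A x y : #|nb A x| <= 1 -> y \in nb A x -> nb A x = [set y].
Proof. by move=> h hy; apply/esym/eqP; rewrite eqEcard sub1set hy cards1. Qed.

Lemma misA_leaf A u l : l \in A -> nb A l = [set u] ->
  misA A = misA (A :\: clN [set l]) + misA (A :\: clN [set u]).
Proof.
move=> lA Nl; have /andP[uA alu] : (u \in A) && adj l u by rewrite -in_nb Nl set11.
rewrite -!card_mises_in // /misA -(cardsID [set I : {set G} | l \in I] (mises A)).
rewrite !setIdE setDE; congr (_ + _); apply: eq_card => I; rewrite !in_setI.
have [/misesP[/subsetP sIA /independentP iI h]|//] := boolP (I \in mises A).
rewrite !inE /=.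
have [uI|uI] := boolP (u \in I).
  by apply/negP => lI; have := iI _ _ lI uI; rewrite alu.
apply/negbTE; rewrite negbK; apply: contraR uI => lI.
have [y yI aly] := h l lA lI.
have : y \in nb A l by rewrite in_nb sIA.
by rewrite Nl => /set1P <-.
Qed.

Lemma misA_edge A v w : v \in A -> w \in A -> adj v w ->
  misA (A :\: clN [set v]) + misA (A :\: clN [set w]) <= misA A.
Proof.
move=> vA wA avw; rewrite -!card_mises_in // /misA.
rewrite -(cardsID [set I : {set G} | v \in I] (mises A)) leq_add //.
  by apply: subset_leq_card; apply/subsetP => I; rewrite !inE.
apply: subset_leq_card; apply/subsetP => I; rewrite in_set => /andP[mI wI].
rewrite in_setD mI andbT inE; apply/negP => vI.
by case/misesP: mI => _ /independentP/(_ _ _ vI wI); rewrite avw.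
Qed.

(** Three disjoint families: the sets through [v], those through [w], and those containing [S],
    which miss [v] and [w] because each has a neighbour in [S]. *)
Lemma misA_edge_avoid A v w S :
    v \in A -> w \in A -> adj v w -> S \subset A -> independent S ->
    (exists2 x, x \in S & adj v x) -> (exists2 x, x \in S & adj w x) ->
  misA (A :\: clN [set v]) + misA (A :\: clN [set w]) + misA (A :\: clN S)
    <= misA A.
Proof.
move=> vA wA avw sSA iS [x xS avx] [y yS awy].
rewrite -!card_mises_in // -card_mises_sup // /misA.
rewrite -(cardsID [set I : {set G} | v \in I] (mises A)) -addnA leq_add //.
  by apply: subset_leq_card; apply/subsetP => I; rewrite !inE.
rewrite -(cardsID [set I : {set G} | w \in I]
  (mises A :\: [set I : {set G} | v \in I])) leq_add //.
  apply: subset_leq_card; apply/subsetP => I; rewrite in_set => /andP[mI wI].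
  rewrite in_setI in_setD mI andbT !inE wI andbT; apply/negP => vI.
  by case/misesP: mI => _ /independentP/(_ _ _ vI wI); rewrite avw.
apply: subset_leq_card; apply/subsetP => I; rewrite in_set => /andP[mI /subsetP sSI].
case/misesP: (mI) => _ /independentP iI _.
rewrite !in_setD mI andbT !inE; apply/andP; split; apply/negP => vI.
  by have := iI _ _ vI (sSI _ yS); rewrite awy.
by have := iI _ _ vI (sSI _ xS); rewrite avx.
Qed.

(** 1-degeneracy, equivalent to acyclicity; it passes to subsets at once and directly yields
    vertices of low degree. *)
Definition forest A :=
  forall B, B \subset A -> B != set0 -> exists2 x, x \in B & #|nb B x| <= 1.

(** The unique cycle as seen from vertex sets: minimum degree 2 forces a cycle, so a set not
    containing [C] has no nonempty subset of minimum degree 2. *)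
Definition one_core C :=
  [/\ C != set0, forall x, x \in C -> #|nb C x| = 2 &
      forall B, B != set0 -> (forall x, x \in B -> 1 < #|nb B x|) -> B = C].

Lemma forestS A B : B \subset A -> forest A -> forest B.
Proof. by move=> sBA fA D sDB; apply: fA; apply: subset_trans sBA. Qed.

Lemma core_forest C A : one_core C -> ~~ (C \subset A) -> forest A.
Proof.
move=> [_ _ hC] nCA B sBA B0.
have [/exists_inP[x xB hx]|no] := boolP [exists x in B, #|nb B x| <= 1].
  by exists x.
case/negP: nCA; rewrite -(hC B) // => x xB; rewrite ltnNge.
by apply: contra no => h; apply/exists_inP; exists x.
Qed.

Lemma core_forestD C A u S : one_core C -> u \in C -> u \in S ->
  forest (A :\: clN S).
Proof.
move=> hC uC uS; apply: core_forest hC _; apply/subsetPn; exists u => //.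
rewrite in_setD negb_and negbK; apply/orP; left; apply/clNP; exists u => //.
by left.
Qed.

(** [w] is the only possible non-leaf neighbour of [u]; when there is none, [u] itself serves as a
    dummy [w]. *)
Definition pendant A u l w :=
  [/\ u \in A, l \in A, nb A l = [set u] &
      forall y, y \in nb A u -> y != w -> nb A y = [set u]].

Definition nonleaf A := [set x in A | 1 < #|nb A x|].

Lemma pendant_edge A x y : x \in A -> y \in A -> adj x y ->
  #|nb A x| <= 1 -> #|nb A y| <= 1 -> pendant A y x y.
Proof.
move=> xA yA axy hx hy.
have nx : nb A x = [set y] by apply: nb_le1; rewrite ?in_nb ?yA.
have ny : nb A y = [set x] by apply: nb_le1; rewrite ?in_nb ?xA // adjC.
by split=> // z; rewrite ny => /set1P ->.
Qed.

Lemma pendant_nonleaf A u : u \in nonleaf A -> #|nb (nonleaf A) u| <= 1 ->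
  exists l w, l \notin nonleaf A /\ pendant A u l w.
Proof.
rewrite inE => /andP[uA du] h.
have leaf y : y \in nb A u -> y \notin nonleaf A -> nb A y = [set u].
  rewrite in_nb => /andP[yA auy]; rewrite inE yA /= -leqNgt => hy.
  by apply: nb_le1; rewrite ?in_nb ?uA // adjC.
have [l lu lA'] : exists2 l, l \in nb A u & l \notin nonleaf A.
  have : ~~ (nb A u \subset nb (nonleaf A) u).
    by apply: contraL du => /subset_leq_card hs; rewrite -leqNgt (leq_trans hs).
  case/subsetPn=> l lu; rewrite in_nb => hl; exists l => //.
  by move: lu hl; rewrite in_nb => /andP[_ ->]; rewrite andbT.
have lA : l \in A by move: lu; rewrite in_nb => /andP[].
have [e0|[w wu]] := set_0Vmem (nb (nonleaf A) u).
  exists l, u; split=> //; split=> // [|y yu _]; first exact: leaf.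
  apply: leaf => //; apply: contraT => /negPn yA'; have : y \in nb (nonleaf A) u.
    by move: yu; rewrite !in_nb yA' => /andP[].
  by rewrite e0 inE.
exists l, w; split=> //; split=> // [|y yu yw]; first exact: leaf.
apply: leaf => //; apply: contra yw => yA'; have : y \in nb (nonleaf A) u.
  by move: yu; rewrite !in_nb yA' => /andP[].
by rewrite (nb_le1 h wu) inE.
Qed.

(** A vertex of degree at most 1 among the non-leaves plays the part of the penultimate vertex of a
    longest path. Without non-leaves the edges form a matching and any of them will do. *)
Lemma forest_pendant A : forest A -> ~~ independent A ->
  exists u l w, pendant A u l w.
Proof.
move=> fA nA; have [e0|n0] := eqVneq (nonleaf A) set0; last first.
  have [|u uA' hu] := fA (nonleaf A) _ n0.
    by apply/subsetP => x; rewrite inE => /andP[].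
  by have [l [w [_ p]]] := pendant_nonleaf uA' hu; exists u, l, w.
have le1 x : x \in A -> #|nb A x| <= 1.
  move=> xA; have : x \notin nonleaf A by rewrite e0 inE.
  by rewrite inE xA -leqNgt.
case/forall_inPn: nA => x xA /forall_inPn[y yA /negPn axy].
by exists y, x, y; apply: pendant_edge; rewrite ?le1.
Qed.

(** Strip the leaves. If more than [C] is left, [one_core] yields a vertex of degree at most 1
    there, outside [C] because vertices of [C] keep both cycle neighbours. If just [C] is left, an
    edge outside [C] is an isolated K_2. *)
Lemma core_cases C A : one_core C -> C \subset A ->
  (exists u l w, [/\ u \notin C, l \notin C & pendant A u l w]) \/
  (independent (A :\: C) /\ forall x, x \in A :\: C -> #|nb A x| <= 1).
Proof.
move=> [C0 rC hC] /[dup] /subsetP sCA sCA'.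
have sC : C \subset nonleaf A.
  apply/subsetP => x xC; rewrite inE sCA // -(rC x xC).
  exact: subset_leq_card (nbS _ sCA').
have [eC|nC] := eqVneq (nonleaf A) C.
  have le1 x : x \in A :\: C -> #|nb A x| <= 1.
    by move=> /setDP[xA]; rewrite -eC inE xA -leqNgt.
  have [iAC|nAC] := boolP (independent (A :\: C)); [by right|left].
  case/forall_inPn: nAC => x xAC /forall_inPn[y yAC /negPn axy].
  exists y, x, y; have := pendant_edge _ _ axy (le1 x xAC) (le1 y yAC).
  by move: xAC yAC; rewrite !inE => /andP[-> ->] /andP[-> ->] /(_ isT isT).
left.
have [/forall_inP h|] := boolP [forall x in nonleaf A, 1 < #|nb (nonleaf A) x|].
  rewrite (hC _ _ h) ?eqxx // in nC.
  by case/set0Pn: C0 => x xC; apply/set0Pn; exists x; apply: (subsetP sC).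
case/forall_inPn=> u uA'; rewrite -leqNgt => hu.
have [l [w [lA' p]]] := pendant_nonleaf uA' hu; exists u, l, w; split=> //.
  apply: contraL hu => uC; rewrite -ltnNge -(rC u uC).
  exact: subset_leq_card (nbS _ sC).
by apply: contra lA'; apply: (subsetP sC).
Qed.

(** N[l] is the pair [l], [u], and [u] covers all edges at either. The set [D] is arbitrary because
    the odd case applies the bound to [A :\: C]. *)
Lemma leaf_bounds A u l : l \in A -> nb A l = [set u] ->
  [/\ #|A :\: clN [set l]| + 2 <= #|A|, #|A :\: clN [set u]| < #|A| &
      forall D, D \subset A -> tau D <= tau (D :\: clN [set l]) + 1].
Proof.
move=> lA Nl; have /andP[uA alu] : (u \in A) && adj l u by rewrite -in_nb Nl set11.
split; last 1 first.
- move=> D /subsetP sDA; rewrite -(cards1 u); apply: tau_del => x y xD yD.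
  rewrite in_clN1 !inE => /orP[/eqP ->|alx _].
    move=> aly; have : y \in nb A l by rewrite in_nb sDA.
    by rewrite Nl inE => ->; rewrite orbT.
  have : x \in nb A l by rewrite in_nb sDA.
  by rewrite Nl inE => ->.
- rewrite -(cardsID (clN [set l]) A) addnC leq_add2r.
  have <- : #|[set l; u]| = 2.
    by rewrite cards2; case: eqP alu => // ->; rewrite adjxx.
  apply: subset_leq_card; apply/subsetP => x /set2P[] ->;
    by rewrite inE in_clN1 ?eqxx ?lA // alu uA orbT.
- exact: clN_proper.
Qed.

(** [u] and [w] cover every edge meeting N[u], the other neighbours of [u] being leaves. *)
Lemma pendant_tau A u l w D : pendant A u l w -> D \subset A ->
  tau D <= tau (D :\: clN [set u]) + 2.
Proof.
move=> [uA lA Nl h] /subsetP sDA.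
apply: leq_trans (_ : _ <= tau (D :\: clN [set u]) + #|[set u; w]|) _; last first.
  by rewrite leq_add2l cards2; case: (_ != _).
apply: tau_del => x y xD yD; rewrite in_clN1 !inE => /orP[->//|aux axy].
have [->|xw] := eqVneq x w; rewrite ?orbT //=.
have : y \in nb A x by rewrite in_nb sDA.
by rewrite h // ?in_nb ?sDA // inE => ->; rewrite !orbT.
Qed.

Lemma tau_eq0 A : independent A -> tau A = 0.
Proof. by move=> iA; apply/eqP; rewrite -leqn0 -(cards0 G) tau_cover ?setD0. Qed.

Lemma set_card_ind (P : {set G} -> Prop) :
  (forall A, (forall B, #|B| < #|A| -> P B) -> P A) -> forall A, P A.
Proof.
move=> h A; elim: {A}_.+1 {-2}A (ltnSn #|A|) => // n IH A hn.
by apply: h => B hB; apply: IH; apply: leq_trans hB hn.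
Qed.

Lemma forest_misA A : forest A -> fib (tau A + 2) <= misA A.
Proof.
elim/set_card_ind: A => A IH fA.
have [iA|nA] := boolP (independent A); first by rewrite tau_eq0 ?misA_gt0.
have [u [l [w p]]] := forest_pendant fA nA; have [uA lA Nl _] := p.
have [c1 c2 /(_ _ (subxx A)) t1] := leaf_bounds lA Nl.
have t2 := pendant_tau p (subxx A).
have h1 := IH (A :\: clN [set l]) ltac:(lia) (forestS (subsetDl _ _) fA).
have h2 := IH (A :\: clN [set u]) c2 (forestS (subsetDl _ _) fA).
rewrite (misA_leaf lA Nl) addn2 fibSS leq_add //.
  by apply: leq_trans h1; apply: leq_fib; lia.
by apply: leq_trans h2; apply: leq_fib; lia.
Qed.

Lemma forest_tau A : forest A -> 2 * tau A <= #|A|.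
Proof.
elim/set_card_ind: A => A IH fA.
have [iA|nA] := boolP (independent A); first by rewrite tau_eq0.
have [u [l [w p]]] := forest_pendant fA nA; have [uA lA Nl _] := p.
have [c1 _ /(_ _ (subxx A)) t1] := leaf_bounds lA Nl.
have := IH (A :\: clN [set l]) _ (forestS (subsetDl _ _) fA); lia.
Qed.

(** * Sets containing the cycle *)

Section Core.
Variable C : {set G}.
Hypothesis hC : one_core C.

Lemma core_nb x : x \in C -> #|nb C x| = 2.
Proof. by case: hC => _ + _; apply. Qed.

Lemma core_tau_gt1 : 1 < tau C.
Proof.
have [K [sK iK <-]] := tau_witness C.
have [/subsetPn[x xC xK]|/negbNE sCK] := boolP (~~ (C \subset K)).
  rewrite -(core_nb xC); apply: subset_leq_card; apply/subsetP => y.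
  rewrite in_nb => /andP[yC axy]; apply: contraLR axy => yK.
  by apply: (independentP _ iK); rewrite inE ?xK ?yK.
have [/set0Pn[x xC] _ _] := hC.
rewrite -(core_nb xC); apply: subset_leq_card; apply: subset_trans sCK.
by apply/subsetP => y; rewrite in_nb => /andP[].
Qed.

(** Removing one vertex of the cycle costs one cover vertex and leaves a forest. For the whole graph
    this says that alpha is at least the floor of n/2. *)
Lemma core_tau A : C \subset A -> 2 * tau A <= #|A| + 1.
Proof.
move=> sCA; have [/set0Pn[x xC] _ _] := hC.
have xA := subsetP sCA x xC.
have := tau_subadd A [set x]; rewrite cards1.
have := forest_tau (core_forest (A := A :\ x) hC _).
rewrite (cardsD1 x A) xA => /(_ _) h1.
have : ~~ (C \subset A :\ x) by apply/subsetPn; exists x; rewrite // !inE eqxx.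
by move=> /h1; lia.
Qed.

Lemma core_sub_leaf A u l : C \subset A -> nb A l = [set u] ->
  u \notin C -> l \notin C -> C \subset A :\: clN [set l].
Proof.
move=> /subsetP sCA Nl uC lC; apply/subsetP => x xC; rewrite in_setD sCA // andbT.
rewrite in_clN1; apply/norP; split; first by apply: contraNneq lC => <-.
apply: contra uC => alx; have : x \in nb A l by rewrite in_nb sCA.
by rewrite Nl => /set1P <-.
Qed.

Lemma core_leaf_tau A u : C \subset A ->
  (forall x, x \in A :\: C -> #|nb A x| <= 1) -> u \in C ->
  tau A <= tau (A :\: clN [set u]) + 3.
Proof.
move=> /subsetP sCA le1 uC.
apply: leq_trans (_ : _ <= tau (A :\: clN [set u]) + #|u |: nb C u|) _; last first.
  by rewrite leq_add2l cardsU1 (core_nb uC); case: (_ \notin _).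
apply: tau_del => x y xA yA; rewrite in_clN1 !inE => /orP[->//|aux axy].
have [xC|xC] := boolP (x \in C); first by rewrite aux orbT.
have : y \in nb A x by rewrite in_nb yA.
rewrite (@nb_le1 A x u) ?in_nb ?sCA //; first by rewrite inE => ->; rewrite !orbT.
  by apply: le1; rewrite inE xC.
by rewrite adjC.
Qed.

(** The two cycle neighbours of [u] suffice without [u], since each edge at [u] inside [C] ends in
    one of them. *)
Lemma core_nb_tau u : u \in C -> tau C <= tau (C :\: clN [set u]) + 2.
Proof.
move=> uC; rewrite -(core_nb uC); apply: tau_del => x y xC yC.
by rewrite in_clN1 !in_nb xC yC => /orP[/eqP->|->] // ->; rewrite orbT.
Qed.

Lemma core_only_tau A : C \subset A ->
  (forall x, x \in A :\: C -> nb A x = set0) -> tau A <= tau C.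
Proof.
move=> /subsetP sCA h; have [K [sK iK <-]] := tau_witness C.
have inC x y : x \in A -> y \in A -> adj x y -> x \in C.
  move=> xA yA axy; apply: contraT => xC; have : y \in nb A x by rewrite in_nb yA.
  by rewrite h inE // xC.
apply: tau_cover; apply/independentP => x y /setDP[xA xK] /setDP[yA yK].
apply/negP => axy; move/independentP/(_ x y): iK.
rewrite !inE xK yK (inC x y) // (inC y x) ?axy //; last by rewrite adjC.
by move=> /(_ isT isT).
Qed.

(** In the inductions over sets containing [C], only [CorePendant] recurses; the other two
    constructors are base cases. *)
Variant core_spec A : Prop :=
  | CorePendant u l w of u \notin C & l \notin C & pendant A u l w
  | CoreLeaf u l of u \in C & l \in A & nb A l = [set u] &
      independent (A :\: C) & tau A <= tau (A :\: clN [set u]) + 3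
  | CoreIsolated of forall x, x \in A :\: C -> nb A x = set0.

Lemma coreP A : C \subset A -> core_spec A.
Proof.
move=> sCA; have [[u [l [w [uC lC p]]]]|[iAC le1]] := core_cases hC sCA.
  exact: CorePendant uC lC p.
have [/exists_inP[l lAC /set0Pn[u ul]]|iso] :=
    boolP [exists l in A :\: C, nb A l != set0]; last first.
  apply: CoreIsolated => x xAC; apply/eqP.
  by apply: contraNT iso => ?; apply/exists_inP; exists x.
have [lA lC] := setDP lAC; have Nl := nb_le1 (le1 l lAC) ul.
move: ul; rewrite in_nb => /andP[uA alu].
suff uC : u \in C by apply: CoreLeaf uC lA Nl iAC (core_leaf_tau sCA le1 uC).
apply: contraT => uC; move/independentP/(_ l u lAC): iAC.
by rewrite inE uC uA alu => /(_ isT).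
Qed.

Lemma core_leaf_forest A u l : u \in C -> nb A l = [set u] ->
  forest (A :\: clN [set l]).
Proof.
move=> uC Nl; have : u \in nb A l by rewrite Nl set11.
rewrite in_nb => /andP[uA alu].
by apply: core_forest hC _; apply/subsetPn; exists u; rewrite // in_setD in_clN1 alu orbT.
Qed.

Lemma core_misA A : C \subset A -> 2 * fib (tau A) <= misA A.
Proof.
elim/set_card_ind: A => A IH sCA.
have tC := core_tau_gt1; have tA := leq_trans tC (leq_tau sCA).
have [u l w uC lC p|u l uC lA Nl iAC t2|iso] := coreP sCA.
- have [uA lA Nl _] := p.
  have [c1 c2 /(_ _ (subxx A)) t1] := leaf_bounds lA Nl.
  have t2 := pendant_tau p (subxx A).
  rewrite (misA_leaf lA Nl).
  have s1 := core_sub_leaf sCA Nl uC lC.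
  have h1 := IH (A :\: clN [set l]) ltac:(lia) s1.
  have h2 : 2 * fib (tau (A :\: clN [set u])) <= misA (A :\: clN [set u]).
    have [s2|ns2] := boolP (C \subset A :\: clN [set u]).
      by apply: IH s2; lia.
    apply: leq_trans (forest_misA (core_forest hC ns2)).
    by rewrite addn2 fibSS mul2n -addnn leq_add2r leq_fib.
  case: (tau A) tA t1 t2 => [|[|t]] // _ t1 t2.
  have f1 : fib t.+1 <= fib (tau (A :\: clN [set l])) by apply: leq_fib; lia.
  have f2 : fib t <= fib (tau (A :\: clN [set u])) by apply: leq_fib; lia.
  rewrite fibSS; lia.
(* Both deletions break the cycle, with losses 1 and 3. For [t = tau A] the forest bounds give
   f(t+1) + f(t-1), which is at least 2f(t). *)
- have [_ _ /(_ _ (subxx A)) t1] := leaf_bounds lA Nl.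
  rewrite (misA_leaf lA Nl).
  have := forest_misA (core_leaf_forest uC Nl).
  have := forest_misA (core_forestD (A := A) hC uC (set11 u)).
  case: (tau A) tA t1 t2 => [|[|t]] // _ t1 t2.
  have : fib t.+3 <= fib (tau (A :\: clN [set l]) + 2) by apply: leq_fib; lia.
  have : fib t.+1 <= fib (tau (A :\: clN [set u]) + 2) by apply: leq_fib; lia.
  have := leq_fib (leqnSn t); rewrite !fibSS; lia.
(* All edges now lie in [C]. For a cycle edge [v w], each of the two deletions leaves a forest and
   loses at most 2, so each gives [fib (tau C)]. *)
have tAC := core_only_tau sCA iso.
have [/set0Pn[v vC] _ _] := hC.
have [w wv] : exists w, w \in nb C v by apply/card_gt0P; rewrite core_nb.
move: wv; rewrite in_nb => /andP[wC avw].
have sub x : x \in C -> x \in A := subsetP sCA x.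
apply: leq_trans (misA_edge (sub v vC) (sub w wC) avw).
rewrite mul2n -addnn; apply: leq_add.
  apply: leq_trans (forest_misA (core_forestD (A := A) hC vC (set11 v))); apply: leq_fib.
  have := core_nb_tau vC; have := leq_tau (setSD (clN [set v]) sCA); lia.
apply: leq_trans (forest_misA (core_forestD (A := A) hC wC (set11 w))); apply: leq_fib.
have := core_nb_tau wC; have := leq_tau (setSD (clN [set w]) sCA); lia.
Qed.

(** The walk may return with [x = u], as on a triangle; irreflexivity then settles the condition. *)
Definition no4cycle :=
  [forall u in C, forall v in nb C u, forall w in nb C v, forall x in nb C w,
    (u != w) && (v != x) ==> ~~ adj u x].

Lemma core_nb2 v u : v \in C -> u \in nb C v ->
  exists2 w, w != u & nb C v = [set u; w].
Proof.
move=> vC uv; have := core_nb vC; rewrite (cardsD1 u) uv => -[/eqP/cards1P[w e]].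
have : w \in nb C v :\ u by rewrite e set11.
by rewrite !inE => /andP[wu _]; exists w; rewrite // -(setD1K uv) e.
Qed.

Lemma core_misA_odd A : no4cycle -> C \subset A ->
  odd_bound (tau C + tau (A :\: C)) <= misA A.
Proof.
move=> no4; elim/set_card_ind: A => A IH sCA.
have tC := core_tau_gt1; have tA := tau_add sCA.
have [u l w uC lC p|u l uC lA Nl iAC _|iso] := coreP sCA.
- have [uA lA Nl _] := p.
  have [c1 c2 /(_ _ (subsetDl A C)) t1] := leaf_bounds lA Nl.
  have t2 := pendant_tau p (subsetDl A C).
  rewrite (misA_leaf lA Nl).
  have DC X : A :\: C :\: X = A :\: X :\: C by rewrite !setDDl setUC.
  rewrite !DC in t1 t2.
  have s1 := core_sub_leaf sCA Nl uC lC.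
  have h1 := IH (A :\: clN [set l]) ltac:(lia) s1.
  (* [r] replaces [s] after deleting N[u]: the same sum if the cycle survives, and otherwise the
     cover number of a forest, whose bound [fib (r + 2)] dominates [odd_bound r]. *)
  have [r hr h2] : exists2 r, tau C + tau (A :\: C) <= r + 2 &
      odd_bound r <= misA (A :\: clN [set u]).
    have [s2|ns2] := boolP (C \subset A :\: clN [set u]).
      by exists (tau C + tau (A :\: clN [set u] :\: C)); [lia|apply: IH s2; lia].
    exists (tau (A :\: clN [set u])).
      by have := pendant_tau p (subxx A); lia.
    apply: leq_trans (forest_misA (core_forest hC ns2)).
    by rewrite addn2 odd_bound_le_fib.
  (* If deleting N[l] does not lower the sum, the first summand suffices. A strict drop together
     with [1 < tau C] forces the sum to be at least 3, as [odd_bound_subadd] requires. *)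
  have [|s3] := leqP (tau C + tau (A :\: C)) (tau C + tau (A :\: clN [set l] :\: C)).
    by move=> /leq_odd_bound; lia.
  move: tC hr s3 h1 t1; set s := tau C + tau (A :\: C) => tC hr s3 h1 t1.
  have [t ht] : exists t, s = t.+3 by exists (s - 3); lia.
  have := leq_odd_bound (_ : t.+2 <= tau C + tau (A :\: clN [set l] :\: C)).
  have := leq_odd_bound (_ : t.+1 <= r).
  by have := odd_bound_subadd t; rewrite ht; lia.
(* The sum is now [s = tau C], and the two forests give f(s+1) + f(s) = f(s+2). *)
- rewrite (tau_eq0 iAC) addn0 in tA *.
  have [_ _ /(_ _ (subxx A)) t1] := leaf_bounds lA Nl.
  rewrite (misA_leaf lA Nl).
  have := forest_misA (core_leaf_forest uC Nl).
  have := forest_misA (core_forestD (A := A) hC uC (set11 u)).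
  have := leq_fib (_ : (tau C).+1 <= tau (A :\: clN [set l]) + 2).
  have := leq_fib (_ : tau C <= tau (A :\: clN [set u]) + 2).
  have := core_nb_tau uC; have := leq_tau (setSD (clN [set u]) sCA).
  have := odd_bound_le_fib (tau C); rewrite fibSS; lia.
rewrite (@tau_eq0 (A :\: C)) ?addn0; last first.
  apply/independentP => x y xAC /setDP[yA _]; apply/negP => axy.
  have : y \in nb A x by rewrite in_nb yA.
  by rewrite iso // inE.
have sub x : x \in C -> x \in A := subsetP sCA x.
(* [t], [u], [v], [w], [x], [y] will be consecutive on [C], with [u = x] on a triangle and [t = y]
   on C_5. The sets counted contain [v], or [w], or both [u] and [x]. *)
have [/set0Pn[v vC] _ _] := hC.
have [w wv] : exists w, w \in nb C v by apply/card_gt0P; rewrite core_nb.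
have [u uw nv] := core_nb2 vC wv.
move: wv; rewrite in_nb => /andP[wC avw].
have [|x xv nw] := @core_nb2 w v wC; first by rewrite in_nb vC adjC.
have [uC avu] : u \in C /\ adj v u by apply/andP; rewrite -in_nb nv !inE eqxx orbT.
have [xC awx] : x \in C /\ adj w x by apply/andP; rewrite -in_nb nw !inE eqxx orbT.
have [|t tv nu] := @core_nb2 u v uC; first by rewrite in_nb vC adjC.
have [|y yw nx] := @core_nb2 x w xC; first by rewrite in_nb wC adjC.
have nux : ~~ adj u x.
  move: no4 => /forall_inP/(_ _ uC)/forall_inP/(_ v); rewrite in_nb vC adjC => /(_ avu).
  move=> /forall_inP/(_ w); rewrite in_nb wC => /(_ avw).
  move=> /forall_inP/(_ x); rewrite in_nb xC => /(_ awx).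
  by rewrite uw eq_sym xv.
have iS : independent [set u; x].
  by apply: independentU; rewrite ?independent1 // => a b /set1P-> /set1P->.
have sSA : [set u; x] \subset A by apply/subsetP => a /set2P[]->; apply: sub.
apply: leq_trans (misA_edge_avoid (sub v vC) (sub w wC) avw sSA iS _ _); first last.
- by exists x; rewrite // !inE eqxx orbT.
- by exists u; rewrite // !inE eqxx.
have fv := forest_misA (core_forestD (A := A) hC vC (set11 v)).
have fw := forest_misA (core_forestD (A := A) hC wC (set11 w)).
have fS := forest_misA (core_forestD (A := A) hC uC (set21 u x)).
apply: leq_trans (_ : _ <= _ + _ + misA (A :\: clN [set u; x])) _; last first.
  by rewrite leq_add2r; apply: leq_add fv fw.
have drop X k : tau C <= tau (C :\: X) + k -> tau C <= tau (A :\: X) + k.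
  by move=> h; apply: leq_trans h _; rewrite leq_add2r leq_tau ?setSD.
apply: odd_bound_edge tC (drop _ _ (core_nb_tau vC)) (drop _ _ (core_nb_tau wC))
  (drop _ _ _) fS (misA_gt0 _).
(* Four vertices cover all edges at N[u] or N[x] inside [C]: edges at [u] end in [t] or [v], and
   edges at [w] in [v] or [x]. This loss of 4 gives the term [fib (s - 2)]. *)
apply: leq_trans (_ : _ <= tau (C :\: clN [set u; x]) + #|[set t; v] :|: [set x; y]|) _.
  apply: tau_del => a b aC bC /clNP[c /set2P[]-> []] => [<-|aua|<-|axa] aab.
  + have : b \in nb C u by rewrite in_nb bC.
    by rewrite nu !inE => /orP[]->; rewrite ?orbT.
  + have : a \in nb C u by rewrite in_nb aC.
    by rewrite nu !inE => /orP[]->; rewrite ?orbT.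
  + by rewrite !inE eqxx !orbT.
  + have : a \in nb C x by rewrite in_nb aC.
    rewrite nx !inE => /orP[/eqP ea|->]; last by rewrite !orbT.
    have : b \in nb C w by rewrite in_nb bC -ea.
    by rewrite nw !inE => /orP[]->; rewrite ?orbT.
rewrite leq_add2l; apply: leq_trans (leq_of_leqif (leq_card_setU _ _)) _.
by rewrite !cards2; case: (_ != _); case: (_ != _).
Qed.

(** The hypothesis is equality in [core_tau]. A leaf step away from [C] preserves it, and the edge
    [l u] pays for one cover vertex of [A :\: C]. A leaf at [C] is impossible: its deletion leaves a
    forest, which would give [2 * tau A <= #|A|]. *)
Lemma core_tight A : C \subset A -> 2 * tau A = #|A| + 1 ->
  tau A <= tau C + tau (A :\: C).
Proof.
elim/set_card_ind: A => A IH sCA tA.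
have [u l w uC lC p|u l uC lA Nl iAC _|iso] := coreP sCA.
- have [uA lA Nl _] := p.
  have s1 := core_sub_leaf sCA Nl uC lC.
  have [c1 _ /(_ _ (subxx A)) t1] := leaf_bounds lA Nl.
  have cA1 := core_tau s1.
  have := IH (A :\: clN [set l]) ltac:(lia) s1 ltac:(lia).
  suff : tau (A :\: clN [set l] :\: C) + 1 <= tau (A :\: C) by lia.
  have alu : adj l u by have := set11 u; rewrite -Nl in_nb => /andP[].
  have sD : A :\: clN [set l] :\: C \subset A :\: C.
    by rewrite !setDDl; apply: setDS; rewrite subsetUr.
  apply: leq_trans (tau_add sD); rewrite leq_add2l lt0n; apply/eqP => t0.
  have [K [_ iK /eqP]] := tau_witness (A :\: C :\: (A :\: clN [set l] :\: C)).
  rewrite t0 cards_eq0 => /eqP K0; move: iK; rewrite K0 setD0.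
  move=> /independentP/(_ l u); rewrite !in_setD !in_clN1 alu eqxx uA lA uC lC !orbT.
  by move=> /(_ isT isT).
- have f1 := forest_tau (core_leaf_forest uC Nl).
  have [c1 _ /(_ _ (subxx A)) t1] := leaf_bounds lA Nl; lia.
- by apply: leq_trans (core_only_tau sCA iso) _; rewrite leq_addr.
Qed.

(** The four vertices have minimum degree 2, so they are [C]. A diagonal would give degree 3, hence
    two opposite vertices form a cover. *)
Lemma core_4cycle : ~~ no4cycle -> #|C| = 4 /\ tau C <= 2.
Proof.
case/forall_inPn=> u uC /forall_inPn[v uv] /forall_inPn[w vw] /forall_inPn[x wx].
rewrite negb_imply negbK => /andP[/andP[nuw nvx] aux].
move: uv vw wx; rewrite !in_nb => /andP[vC auv] /andP[wC avw] /andP[xC awx].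
have ne (a b : G) : adj a b -> a != b.
  by move=> ab; apply/eqP => eab; rewrite eab adjxx in ab.
have eC : [set u; w] :|: [set v; x] = C.
  case: hC => _ _; apply; first by apply/set0Pn; exists u; rewrite !inE eqxx.
  have two (y a b : G) : a != b -> adj y a -> adj y b -> a \in [set u; w] :|: [set v; x] ->
      b \in [set u; w] :|: [set v; x] -> 1 < #|nb ([set u; w] :|: [set v; x]) y|.
    move=> ab ya yb ha hb; have <- : #|[set a; b]| = 2 by rewrite cards2 ab.
    by apply: subset_leq_card; apply/subsetP => z /set2P[]->; rewrite in_nb ?ha ?hb ?ya ?yb.
  move=> y /setUP[]/set2P[]->.
  - by apply: (two _ v x) => //; rewrite !inE eqxx ?orbT.
  - by apply: (two _ v x); rewrite // 1?adjC // !inE eqxx ?orbT.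
  - by apply: (two _ u w); rewrite // 1?adjC // !inE eqxx ?orbT.
  - by apply: (two _ u w); rewrite // 1?adjC // !inE eqxx ?orbT.
have c4 : #|C| = 4.
  rewrite -eC cardsU !cards2 nuw nvx (_ : _ :&: _ = set0) ?cards0 //.
  apply/setP => y; rewrite !inE; apply/negP => /andP[/orP[]/eqP->].
    by rewrite (negPf (ne _ _ auv)) (negPf (ne _ _ aux)).
  by rewrite eq_sym (negPf (ne _ _ avw)) (negPf (ne _ _ awx)).
split=> //; have <- : #|[set u; w]| = 2 by rewrite cards2 nuw.
apply: tau_cover; rewrite -eC setDUl setDv set0U.
suff nvx' : ~~ adj v x.
  apply: independentS (subsetDl _ _) _; apply: independentU; rewrite ?independent1 //.
  by move=> a b /set1P-> /set1P->.
apply/negP => avx; have := core_nb vC; suff : 2 < #|nb C v| by move=> + e; rewrite e.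
have <- : #|x |: [set u; w]| = 3.
  by rewrite cardsU1 cards2 nuw !inE negb_or eq_sym (ne _ _ aux) eq_sym (ne _ _ awx).
apply: subset_leq_card; apply/subsetP => z; rewrite in_nb !inE.
by move=> /or3P[]/eqP->; rewrite ?xC ?uC ?wC // adjC.
Qed.

End Core.
End LowerBound.

(** * The core of a unicyclic graph *)

Section CycleFree.
Variables (T : finType) (e : rel T).
Hypotheses (eC : symmetric e) (exx : irreflexive e).
Implicit Types B : {set T}.

(* A longest path cannot be extended at its head, whose second neighbour
   therefore lies further along the path and closes a cycle. *)
Lemma mindeg2_cycle B : B != set0 ->
    (forall x, x \in B -> 1 < #|[set y in B | e x y]|) ->
  exists c, [/\ 2 < size c, ucycle e c & {subset c <= B}].
Proof.
case/set0Pn=> x0 x0B h.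
suff ext n : forall x p, path e x p -> uniq (x :: p) -> {subset x :: p <= B} ->
    #|T| - size p <= n -> exists c, [/\ 2 < size c, ucycle e c & {subset c <= B}].
  by apply: (ext #|T| x0 [::]); rewrite ?subn0 // => y; rewrite inE => /eqP->.
elim: n => [|n IH] x p ep up sp hn.
  have := max_card (mem (x :: p)); rewrite (card_uniqP up) -[size _]/(size p).+1.
  by move: hn; lia.
have xB : x \in B by apply: sp; rewrite mem_head.
have [/existsP[y /andP[/setIdP[yB exy] yp]]|no] :=
    boolP [exists y, (y \in [set y in B | e x y]) && (y \notin x :: p)].
  apply: (IH y (x :: p)).
  - by rewrite /= eC exy.
  - by rewrite cons_uniq yp.
  - by move=> z; rewrite inE => /orP[/eqP->//|/sp].
  - by move: hn => /=; lia.
have inp y : y \in B -> e x y -> y \in p.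
  move=> yB exy; apply: contraNT no => yp; apply/existsP; exists y.
  rewrite in_set yB exy in_cons negb_or yp !andbT /=.
  by apply/eqP => exy'; rewrite exy' exx in exy.
case: p ep up sp hn inp {no} => [|z p] ep up sp hn inp.
  have /card_gt0P[y] := ltnW (h x xB).
  by rewrite inE => /andP[yB /inp] => /(_ yB).
have [y] : exists y, y \in [set y in B | e x y] :\ z.
  apply/card_gt0P; have := h x xB; rewrite (cardsD1 z); case: (_ \in _); lia.
rewrite !inE => /and3P[yz yB exy].
have := inp y yB exy; rewrite inE (negPf yz) /= => yp.
case/splitPr: yp ep up sp hn inp => p1 p2 ep up sp _ _.
exists (x :: z :: p1 ++ [:: y]); split=> [||t ht].
- by rewrite /= size_cat addn1.
- apply/andP; split.
    rewrite /= cats1 !rcons_path last_rcons (eC y) exy andbT.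
    by move: ep; rewrite /= cat_path /= => /and3P[-> -> /andP[->]].
  move: up; rewrite -cat_rcons -[x :: _]/((x :: z :: rcons p1 y) ++ p2) cats1.
  by rewrite cat_uniq => /andP[].
- apply: sp; move: ht; rewrite !inE !mem_cat !inE.
  by case/or3P=> [->|->|/orP[]->]; rewrite ?orbT.
Qed.

(** The edge count of a forest, doubled: peeling off a vertex of degree at most 1 lowers the degree
    sum by at most 2, down to 0 for a single vertex. *)
Lemma degenerate_degsum :
    (forall B, B != set0 -> exists2 x, x \in B & #|[set y in B | e x y]| <= 1) ->
  forall B, B != set0 -> \sum_(x in B) #|[set y in B | e x y]| + 2 <= 2 * #|B|.
Proof.
move=> deg B; elim: {B}_.+1 {-2}B (ltnSn #|B|) => // n IH B hn B0.
have [x xB hx] := deg B B0.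
have [e0|n0] := eqVneq (B :\ x) set0.
  have -> : B = [set x] by rewrite -(setD1K xB) e0 setU0.
  rewrite big_set1 cards1 (_ : [set _ in _ | _] = set0) ?cards0 //.
  by apply/setP => y; rewrite !inE; case: eqP => // ->; rewrite exx.
have cB : #|B| = #|B :\ x|.+1 by rewrite (cardsD1 x) xB.
have := IH (B :\ x) ltac:(lia) n0.
rewrite (big_setD1 x xB) /=.
have -> : \sum_(y in B :\ x) #|[set z in B | e y z]| =
    \sum_(y in B :\ x) #|[set z in B :\ x | e y z]| + \sum_(y in B :\ x) e y x.
  rewrite -big_split; apply: eq_bigr => y _ /=.
  rewrite (cardsD1 x) inE xB /= addnC; congr (_ + _).
  by apply: eq_card => z; rewrite !inE andbA.
have -> : \sum_(y in B :\ x) e y x = #|[set y in B | e x y]|.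
  rewrite -sum1_card big_mkcond [RHS]big_mkcond /=; apply: eq_bigr => y _.
  rewrite !inE eC; case: eqP => [->|_]; first by rewrite exx andbF.
  by case: (y \in B); case: (e x y).
lia.
Qed.

End CycleFree.

Lemma next_cycle_neq (T : eqType) (c : seq T) x :
  2 < size c -> uniq c -> x \in c -> next c (next c x) != x.
Proof.
move=> hs uc xc; have [i p def] := rot_to xc.
rewrite -(next_rot i uc) -(next_rot i uc x) def.
have : uniq (x :: p) by rewrite -def rot_uniq.
have : 2 < size (x :: p) by rewrite -def size_rot.
case: p {def} => [|y [|z p]] //= _; rewrite !inE !negb_or => /and3P[].
case/and3P=> xy xz _ _ _; by rewrite !eqxx (eq_sym y) (negPf xy) eq_sym.
Qed.

Section Unicyclic.
Variable G : sgraph.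
Implicit Types (A B C : {set G}) (x y z : G).

Let adjC : symmetric (@adj G) := @adj_sym G.
Let adjxx : irreflexive (@adj G) := @adj_irr G.

Definition del_edge (s : {set G}) : rel G :=
  [rel x y | adj x y && ([set x; y] != s)].

Lemma del_edgeC s : symmetric (del_edge s).
Proof. by move=> x y; rewrite /del_edge /= adjC setUC. Qed.

Lemma del_edgexx s : irreflexive (del_edge s).
Proof. by move=> x; rewrite /del_edge /= adjxx. Qed.

(* Deleting an edge of the only cycle leaves a 1-degenerate graph, so that the
   degree sum over a vertex set B is at most 2|B|; minimum degree 2 then forces
   B to be 2-regular and to contain both ends of every edge of the cycle. *)
Lemma unicyclic_core : unicyclic G -> exists C, one_core C.
Proof.
move=> [_ [E [[c [hs /andP[cc uc] defE]] uniqE]]].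
(* A cycle avoiding this edge would, by uniqueness, have the same edge set as [c], including the
   deleted edge. *)
have degen x : x \in c -> forall B, B != set0 ->
    exists2 y, y \in B & #|[set z in B | del_edge [set x; next c x] y z]| <= 1.
  move=> xc B B0.
  have [/exists_inP//|/exists_inPn no] := boolP [exists y in B,
    #|[set z in B | del_edge [set x; next c x] y z]| <= 1].
  have [y yB|d [ds /andP[cd ud] _]] :=
    mindeg2_cycle (@del_edgeC [set x; next c x]) (@del_edgexx _) B0.
    by rewrite ltnNge no.
  have cadj : cycle (@adj G) d.
    by apply: sub_cycle cd => y z /andP[].
  have ed : E = [set [set x; next d x] | x in d].
    by apply: uniqE; exists d; split=> //; rewrite /ucycle cadj.
  have : [set x; next c x] \in E by rewrite defE; apply: imset_f.
  rewrite ed => /imsetP[y yd eq].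
  by have := next_cycle cd yd; rewrite /del_edge /= -eq eqxx andbF.
have c_nb x B : x \in c -> {subset c <= B} -> 1 < #|nb B x|.
  move=> xc sB.
  have <- : #|[set next c x; prev c x]| = 2.
    rewrite cards2 (_ : _ != _) //; have := next_cycle_neq hs uc (_ : prev c x \in c).
    by rewrite next_prev // mem_prev => /(_ xc).
  apply: subset_leq_card; apply/subsetP => y /set2P[]->; rewrite in_nb sB ?mem_next ?mem_prev //=.
    exact: next_cycle cc xc.
  by rewrite adjC; apply: prev_cycle cc xc.
have reg B : B != set0 -> (forall x, x \in B -> 1 < #|nb B x|) ->
    (forall x, x \in B -> #|nb B x| = 2) /\ {subset c <= B}.
  move=> B0 h.
  (* If an end of this edge lay outside [B], deleting the edge would change no degree in [B],
     against [degen]. *)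
  have sub x : x \in c -> (x \in B) && (next c x \in B).
    move=> xc; have [y yB] := degen x xc B B0; apply: contraTT => nB.
    rewrite -ltnNge (leq_trans (h y yB)) //; apply: subset_leq_card.
    apply/subsetP => z; rewrite in_nb inE => /andP[zB ayz]; rewrite zB /del_edge /= ayz /=.
    apply: contra nB => /eqP eq; have := set21 x (next c x).
    have := set22 x (next c x).
    by rewrite -eq => /set2P[]-> /set2P[]->; rewrite ?yB ?zB.
  split=> [|x /sub/andP[]//].
  have [x0 x0c] : exists x, x \in c by case: (c) hs => // x s _; exists x; rewrite mem_head.
  set s0 := [set x0; next c x0].
  have hsum := degenerate_degsum (@del_edgeC s0) (@del_edgexx s0) (degen x0 x0c) B0.
  have le y : y \in B -> #|nb B y| <= #|[set z in B | del_edge s0 y z]| + (y \in s0).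
    move=> yB; have [ys|ys] := boolP (y \in s0); last first.
      rewrite addn0; apply: subset_leq_card; apply/subsetP => z.
      rewrite in_nb inE /del_edge => /andP[-> /= ->]; apply: contraNneq ys => <-.
      by rewrite set21.
    have [z' ez'] : exists z', s0 = [set y; z'].
      move: ys => /set2P[]->; first by exists (next c x0).
      by exists x0; rewrite setUC.
    rewrite addn1 -[X in _ <= X]add1n -(cards1 z').
    apply: leq_trans (_ : _ <= #|z' |: [set z in B | del_edge s0 y z]|) _; last first.
      by rewrite cardsU leq_subr.
    apply: subset_leq_card; apply/subsetP => z; rewrite in_nb !inE /del_edge => /andP[-> /= ->].
    have [//|zz /=] := eqVneq z z'.
    apply: contraNneq zz => eq; have := set22 y z.
    rewrite eq ez' => /set2P[ezy|->//].
    have := set22 y z'; rewrite -ez' -eq ezy.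
    by move=> /set2P[]->.
  (* The [+ 2] in [hsum] pays for the two ends of the restored edge. *)
  have sum2 : \sum_(y in B) #|nb B y| <= 2 * #|B|.
    apply: leq_trans hsum.
    apply: (@leq_trans (\sum_(y in B)
      (#|[set z in B | del_edge s0 y z]| + (y \in s0)))); first exact: leq_sum.
    rewrite big_split /= leq_add2l.
    have <- : #|s0| = 2.
      rewrite cards2; case: eqP => // e; have := next_cycle cc x0c.
      by rewrite -e adjxx.
    rewrite -sum1_card [X in _ <= X]big_mkcond [X in X <= _]big_mkcond.
    by apply: leq_sum => y _; case: (y \in B); case: (y \in s0).
  move=> x xB; apply/eqP; rewrite eqn_leq h // andbT leqNgt; apply/negP => gt.
  move: sum2; rewrite (big_setD1 x xB) /=.
  have : \sum_(y in B :\ x) 2 <= \sum_(y in B :\ x) #|nb B y|.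
    by apply: leq_sum => y /setD1P[_ yB]; apply: h.
  by rewrite sum_nat_const (cardsD1 x B) xB; lia.
pose C := [set x in c].
have sC : {subset c <= C} by move=> x; rewrite inE.
have C0 : C != set0 by case: (c) hs @C {sC} => // x s _ C; apply/set0Pn;
  exists x; rewrite inE mem_head.
have [rC _] := reg C C0 (fun x xC => c_nb x C (etrans (esym (in_set _ _)) xC) sC).
exists C; split=> // B B0 hB; have [rB sB] := reg B B0 hB.
have sCB : C \subset B by apply/subsetP => x; rewrite inE => /sB.
apply/eqP; rewrite eqEsubset sCB andbT -setD_eq0; apply: contraT => D0.
(* Vertices of [C] have both their [B]-neighbours in [C], so [B :\: C] keeps minimum degree 2; then
   [reg] would place the cycle inside it. *)
have [|_ sD] := reg (B :\: C) D0.
  move=> x /setDP[xB xC]; apply: leq_trans (hB x xB) _; apply: subset_leq_card.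
  apply/subsetP => y; rewrite !in_nb in_setD => /andP[yB axy]; rewrite yB axy !andbT.
  apply: contra xC => yC; have : x \in nb B y by rewrite in_nb xB adjC.
  have -> : nb B y = nb C y.
    by apply/esym/eqP; rewrite eqEcard nbS // rB ?rC // (subsetP sCB).
  by rewrite in_nb => /andP[].
case/set0Pn: C0 => x xC; have := sD x; rewrite -{1}[x \in c](in_set (mem c)) xC.
by rewrite in_setD xC => /(_ isT).
Qed.
End Unicyclic.

(** * The lower bound for unicyclic graphs *)

Lemma misA_ge3 (G : sgraph) (C : {set G}) :
  connected G -> one_core C -> #|G| != 4 -> 3 <= misA [set: G].
Proof.
move=> cG hC n4; have sCT := subsetT C; have tC := core_tau_gt1 hC.
have [no4|/(core_4cycle hC)[c4 _]] := boolP (no4cycle C).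
  apply: leq_trans (core_misA_odd hC no4 sCT).
  by apply: (@leq_odd_bound 2); apply: leq_trans tC (leq_addr _ _).
(* [C] is a 4-cycle. At a leaf [l], deleting N[l] contributes at least 2 and deleting N[u] at least
   1. With no edge outside [C], connectedness makes [C] the whole graph, against [n4]. *)
have [u l w uC lC p|u l uC lA Nl iAC _|iso] := coreP hC sCT.
- have [uA lA Nl _] := p; rewrite (misA_leaf lA Nl).
  have s1 := core_sub_leaf sCT Nl uC lC.
  have := core_misA hC s1; have := misA_gt0 ([set: G] :\: clN [set u]).
  have := leq_fib (leq_trans tC (leq_tau s1)); rewrite -[fib 2]/1; lia.
- have [_ _ /(_ _ (subsetT C)) t1] := leaf_bounds lA Nl.
  rewrite (misA_leaf lA Nl).
  have := forest_misA (core_leaf_forest hC uC Nl).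
  have := misA_gt0 ([set: G] :\: clN [set u]).
  have := leq_tau (setSD (clN [set l]) sCT).
  have := @leq_fib 3 (tau ([set: G] :\: clN [set l]) + 2); rewrite -[fib 3]/2; lia.
case/negP: n4; rewrite -c4 -cardsT; apply/eqP; congr #|pred_of_set _|.
apply/setP => x; rewrite inE; apply/esym.
have [/set0Pn[y yC] _ _] := hC.
rewrite -(@closed_connect _ (@adj G) (mem C) _ y x) // => a b ab.
have out c d : adj c d -> c \in C -> d \in C.
  rewrite adj_sym => dc cC; apply: contraT => dC.
  have : c \in nb setT d by rewrite in_nb inE.
  by rewrite iso ?inE ?dC.
by apply/idP/idP; apply: out; rewrite // adj_sym.
Qed.

Lemma unicyclic_mis_bound (G : sgraph) : unicyclic G -> 3 <= #|G| ->
  exists2 b, mis_bound #|G| (indep_num G) = Some b & b <= mis G.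
Proof.
move=> uG n3; have [C hC] := unicyclic_core uG; have cG := uG.1.
have sCT := subsetT C; have tC := core_tau_gt1 hC.
have tT := leq_tau sCT; have bT := core_tau hC sCT.
rewrite misT alphaT /mis_bound; have := tau_alpha [set: G]; rewrite cardsT => eT.
rewrite cardsT in bT.
have mT := core_misA hC sCT.
set n := #|G| in n3 eT bT *; set a := alpha setT in eT *.
case: ifP => [/andP[n4 a2]|h4].
  have t2 : tau [set: G] = 2 by lia.
  by exists 2; rewrite // t2 in mT *.
case: ifP => [/andP[_ n4]|h2].
  by exists 3 => //; apply: misA_ge3 cG hC n4.
case: ifP => [_|h3].
  by exists (2 * fib (n - a)); rewrite // -eT addnK.
(* With the earlier guards false, [tC] and [bT] leave only odd n with alpha the floor of n/2. *)
have tight : 2 * tau [set: G] = #|[set: G]| + 1 by rewrite cardsT -/n; lia.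
have -> : [&& 4 < n, odd n & a == n./2] by lia.
exists (odd_bound (n - a)) => //.
have sep := core_tight hC sCT tight.
(* For a 4-cycle, [tau C <= 2] and the forest bound on the other n - 4 vertices make the sum at most
   n/2, below the value (n+1)/2 forced by [sep] and [tight]. *)
have no4 : no4cycle C.
  apply/negPn/negP => /(core_4cycle hC)[c4 tC2].
  have := forest_tau (core_forest (A := setT :\: C) hC _).
  have -> : ~~ (C \subset setT :\: C).
    have [/set0Pn[x xC] _ _] := hC.
    by apply/subsetPn; exists x; rewrite // inE xC.
  move=> /(_ isT); rewrite cardsD setTI cardsT -/n; lia.
apply: leq_trans (core_misA_odd hC no4 sCT); apply: leq_odd_bound; lia.
Qed.

(** * Adding a leaf *)

Section Transfer.
Variables (G H : sgraph) (f : G -> H).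
Hypotheses (finj : injective f) (fadj : forall x y, adj (f x) (f y) = adj x y).
Implicit Types A S : {set G}.

Lemma independent_imset S : independent (f @: S) = independent S.
Proof.
apply/independentP/independentP => h x y.
  by move=> xS yS; rewrite -fadj; apply: h; rewrite mem_imset.
by move=> /imsetP[a aS ->] /imsetP[b bS ->]; rewrite fadj; apply: h.
Qed.

Lemma sub_imset_ex (S' : {set H}) A : S' \subset f @: A ->
  exists2 S : {set G}, S \subset A & S' = f @: S.
Proof.
move=> /subsetP h; exists [set x in A | f x \in S'].
  by apply/subsetP => x; rewrite inE => /andP[].
apply/setP => y; apply/idP/imsetP => [yS|[x + ->]]; last by rewrite !inE => /andP[].
by have /imsetP[x xA e] := h y yS; exists x; rewrite // !inE xA -e.
Qed.

Lemma alpha_imset A : alpha (f @: A) = alpha A.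
Proof.
apply/eqP; rewrite eqn_leq; apply/andP; split.
  have [S' [/sub_imset_ex[S sSA ->]]] := alpha_witness (f @: A).
  by rewrite independent_imset => iS <-; rewrite card_imset //; apply: leq_alpha.
have [S [sSA iS <-]] := alpha_witness A.
by rewrite -(card_imset _ finj) leq_alpha ?imsetS ?independent_imset.
Qed.

Lemma misA_imset A : misA (f @: A) = misA A.
Proof.
rewrite /misA -(card_imset (mises A) (imset_inj finj)); apply: eq_card => S'.
apply/misesP/imsetP => [[/sub_imset_ex[S sSA ->]]|[S /misesP[sSA iS h] ->]].
  rewrite independent_imset => iS h; exists S => //; apply/misesP; split=> // x xA xS.
  have [||_ /imsetP[y yS ->]] := h (f x); rewrite ?mem_imset //.
  by rewrite fadj; exists y.
split; rewrite ?imsetS ?independent_imset // => _ /imsetP[x xA ->].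
rewrite mem_imset // => xS; have [y yS axy] := h x xA xS.
by exists (f y); rewrite ?mem_imset ?fadj.
Qed.

End Transfer.

(** An independent set meets N[l] in at most one vertex, which may be taken to be [l]. Isolated [l]
    is included, for use after the neighbour of an added leaf is deleted. *)
Lemma alpha_leaf (G : sgraph) (A : {set G}) (l : G) :
  l \in A -> #|nb A l| <= 1 -> alpha A = alpha (A :\: clN [set l]) + 1.
Proof.
move=> lA hl; apply/eqP; rewrite eqn_leq; apply/andP; split; last first.
  have [S [/subsetP sS iS <-]] := alpha_witness (A :\: clN [set l]).
  have lS : l \notin S by apply/negP => /sS; rewrite in_setD in_clN1 eqxx.
  have <- : #|l |: S| = #|S| + 1 by rewrite cardsU1 lS addnC.
  apply: leq_alpha; first by rewrite subUset sub1set lA; apply/subsetP => x /sS /setDP[].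
  apply: independentU; rewrite ?independent1 // => _ y /set1P-> /sS.
  by rewrite in_setD in_clN1 negb_or => /andP[/andP[]].
have [S [sSA iS <-]] := alpha_witness A.
rewrite -(cardsID (clN [set l]) S) addnC leq_add //.
  by apply: leq_alpha; [apply: setSD|apply: independentS iS; apply: subsetDl].
have [lS|lS] := boolP (l \in S).
  rewrite -(cards1 l); apply: subset_leq_card; apply/subsetP => x.
  rewrite in_setI in_clN1 inE => /andP[xS /orP[//|alx]].
  by have := independentP _ iS _ _ lS xS; rewrite alx.
apply: leq_trans hl; apply: subset_leq_card; apply/subsetP => x.
rewrite in_setI in_clN1 in_nb => /andP[xS /orP[/eqP e|->]]; first by rewrite -e xS in lS.
by rewrite (subsetP sSA).
Qed.

Lemma misA_isolated (G : sgraph) (A : {set G}) (z : G) :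
  z \in A -> nb A z = set0 -> misA A = misA (A :\: clN [set z]).
Proof.
move=> zA nz; rewrite -card_mises_in // setIdE; congr #|pred_of_set _|.
apply/esym/setIidPl/subsetP => I /misesP[/subsetP sIA _ h]; rewrite inE.
apply: contraT => /(h z zA)[y yI azy].
have : y \in nb A z by rewrite in_nb sIA.
by rewrite nz inE.
Qed.

Lemma cycle_nb (G : sgraph) (c : seq G) (x : G) :
  2 < size c -> ucycle (@adj G) c -> x \in c ->
  [/\ next c x != prev c x, adj x (next c x) & adj x (prev c x)].
Proof.
move=> hs /andP[cc uc] xc; split.
- have := next_cycle_neq hs uc (_ : prev c x \in c).
  by rewrite next_prev // mem_prev => /(_ xc).
- exact: next_cycle cc xc.
- by rewrite adj_sym; apply: prev_cycle cc xc.
Qed.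

Section AddLeaf.
Variables (G : sgraph) (u : G).

Definition add_leaf_adj : rel (option G) := fun x y =>
  match x, y with
  | Some a, Some b => adj a b
  | Some a, None | None, Some a => a == u
  | None, None => false
  end.

Lemma add_leaf_sym : symmetric add_leaf_adj.
Proof. by case=> [a|] [b|] //=; rewrite adj_sym. Qed.

Lemma add_leaf_irr : irreflexive add_leaf_adj.
Proof. by case=> [a|] //=; rewrite adj_irr. Qed.

Definition add_leaf := SGraph add_leaf_sym add_leaf_irr.
Definition old (x : G) : add_leaf := Some x.
Definition leaf : add_leaf := None.

Lemma old_inj : injective old.
Proof. by move=> x y []. Qed.

Lemma adj_old x y : adj (old x) (old y) = adj x y.
Proof. by []. Qed.

Lemma add_leaf_connected : connected G -> connected add_leaf.
Proof.
move=> cG.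
have sub x y : connect (@adj add_leaf) (old x) (old y).
  have /connectP[p + ->] := cG x y; elim: p x => [|z p IH] x //= /andP[axz /IH].
  by apply: connect_trans; apply: connect1.
have lu : connect (@adj add_leaf) leaf (old u) by apply: connect1; rewrite /= eqxx.
have cs := sym_connect_sym add_leaf_sym.
case=> [x|] [y|]; [exact: sub| | |exact: connect0].
  by rewrite (cs (Some x)); apply: connect_trans lu (sub u x).
exact: connect_trans lu (sub u y).
Qed.

(** A vertex of a cycle has distinct successor and predecessor, but the new leaf has a single
    neighbour. *)
Lemma add_leaf_cycle (c : seq add_leaf) : 2 < size c -> ucycle (@adj add_leaf) c ->
  exists2 d : seq G, ucycle (@adj G) d & c = map old d.
Proof.
move=> hs uc; have nl : leaf \notin c.
  apply/negP => /(cycle_nb hs uc)[].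
  by case: (next _ _) => [a|] //; case: (prev _ _) => [b|] // + /eqP e1 /eqP e2; rewrite e1 e2 eqxx.
have [d ed] : exists d, c = map old d.
  elim: (c) nl => [|x s IH]; first by exists [::].
  rewrite in_cons negb_or => /andP[+ /IH[d ->]]; case: x => // x _.
  by exists (x :: d).
exists d => //; case/andP: uc; rewrite ed (map_inj_uniq old_inj) => cd ud.
rewrite /ucycle ud andbT; case: (d) cd => // x s.
by rewrite /= -map_rcons path_map.
Qed.

Lemma cycle_edges_old (d : seq G) : uniq d ->
  [set [set x; next (map old d) x] | x in map old d] =
  [set old @: (s : {set G}) | s in [set [set x; next d x] | x in d]].
Proof.
move=> ud; rewrite -imset_comp; apply/setP => s; apply/imsetP/imsetP.
  move=> [_ /mapP[x xd ->] ->]; exists x => //=.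
  by rewrite imsetU1 imset_set1 next_map //; apply: old_inj.
move=> [x xd ->]; exists (old x); first exact: map_f.
by rewrite /= imsetU1 imset_set1 next_map //; apply: old_inj.
Qed.

Lemma add_leaf_unicyclic : unicyclic G -> unicyclic add_leaf.
Proof.
move=> [cG [E [[d [hs ud eE]] uE]]]; split; first exact: add_leaf_connected.
exists [set old @: (s : {set G}) | s in E]; split.
  exists (map old d); case/andP: (ud) => cd uqd; split; first by rewrite size_map.
    rewrite /ucycle (map_inj_uniq old_inj) uqd andbT.
    by case: (d) cd => // x s; rewrite /= -map_rcons path_map.
  by rewrite eE cycle_edges_old.
move=> _ [c [cs uc ->]]; have [d' ud' e] := add_leaf_cycle cs uc.
rewrite e cycle_edges_old; last by case/andP: ud'.
by rewrite -(uE [set [set x; next d' x] | x in d']) //; exists d'; split=> //;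
  rewrite e size_map in cs.
Qed.

Lemma setT_leaf : setT :\ leaf = old @: setT.
Proof.
apply/setP => -[x|]; rewrite !inE; first by rewrite mem_imset ?inE //; apply: old_inj.
by rewrite eqxx; apply/esym/negbTE/imsetP => -[].
Qed.

Lemma setT_clN_leaf : setT :\: clN [set leaf] = old @: (setT :\ u).
Proof.
apply/setP => -[x|]; rewrite in_setD in_clN1 !inE.
  by rewrite (mem_imset _ _ old_inj) !inE.
by rewrite eqxx; apply/esym/negbTE/imsetP => -[].
Qed.

Lemma setT_clN_old : setT :\: clN [set old u] = old @: (setT :\: clN [set u]).
Proof.
apply/setP => -[x|]; rewrite in_setD in_clN1 in_setT andbT.
  by rewrite (mem_imset _ _ old_inj) in_setD in_clN1 in_setT andbT.
by rewrite /= eqxx; apply/esym/negbTE/imsetP => -[].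
Qed.

Lemma setT_old_clN : setT :\ old u :\: clN [set leaf] = old @: (setT :\ u).
Proof.
apply/setP => -[x|]; rewrite in_setD in_clN1 !inE.
  by rewrite (mem_imset _ _ old_inj) !inE andbT -[Some x == old u]/(x == u) /=;
    case: (x == u).
by rewrite eqxx; apply/esym/negbTE/imsetP => -[].
Qed.

Lemma nb_leaf : nb setT leaf = [set old u].
Proof. by apply/setP => -[x|]; rewrite in_nb !inE. Qed.

Lemma nb_leaf_old : nb (setT :\ old u) leaf = set0.
Proof. by apply/setP => -[x|]; rewrite in_nb !inE //= andbT andNb. Qed.

Lemma misA_add_leaf : misA [set: add_leaf] =
  misA (setT :\ u) + misA (setT :\: clN [set u]).
Proof.
rewrite (misA_leaf (in_setT leaf) nb_leaf) setT_clN_leaf setT_clN_old.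
by rewrite !(misA_imset old_inj adj_old).
Qed.

Lemma alpha_add_leaf : alpha [set: add_leaf] = alpha (setT :\ u) + 1.
Proof.
rewrite (@alpha_leaf _ _ leaf) ?in_setT ?nb_leaf ?cards1 // setT_clN_leaf.
by rewrite (alpha_imset old_inj adj_old).
Qed.

End AddLeaf.

(* Adding a leaf at the root u acts on this tuple of invariants of G, G - u and
   G - N[u] by a fixed recurrence. *)
Definition realizable n al al' a b c :=
  exists (G : sgraph) (u : G),
    [/\ unicyclic G, #|G| = n, alpha [set: G] = al /\ alpha (setT :\ u) = al' &
     [/\ misA [set: G] = a, misA (setT :\ u) = b & misA (setT :\: clN [set u]) = c]].

(** The root stays at [u]: deleting [u] isolates the new leaf, and N[u] absorbs it. *)
Lemma realizable_keep n al al' a b c : realizable n al al' a b c ->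
  realizable n.+1 al'.+1 al'.+1 (b + c) b c.
Proof.
move=> [G [u [uG <- [_ <-] [_ <- <-]]]]; exists (add_leaf u), (old u u); split.
- exact: add_leaf_unicyclic.
- by rewrite card_option.
- rewrite alpha_add_leaf addn1; split=> //.
  rewrite (@alpha_leaf _ _ (leaf u)) ?nb_leaf_old ?cards0 ?inE // setT_old_clN.
  by rewrite (alpha_imset (@old_inj _ u) (@adj_old _ u)) addn1.
- rewrite misA_add_leaf (@misA_isolated _ _ (leaf u)) ?nb_leaf_old ?inE //.
  by rewrite setT_old_clN setT_clN_old !(misA_imset (@old_inj _ u) (@adj_old _ u)).
Qed.

(** The root moves to the new leaf: deleting it restores G, and deleting its closed neighbourhood
    leaves G - u. *)
Lemma realizable_move n al al' a b c : realizable n al al' a b c ->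
  realizable n.+1 al'.+1 al (b + c) a b.
Proof.
move=> [G [u [uG <- [<- <-] [<- <- <-]]]]; exists (add_leaf u), (leaf u); split.
- exact: add_leaf_unicyclic.
- by rewrite card_option.
- by rewrite alpha_add_leaf addn1 setT_leaf (alpha_imset (@old_inj _ u) (@adj_old _ u)).
- by rewrite misA_add_leaf setT_leaf setT_clN_leaf !(misA_imset (@old_inj _ u) (@adj_old _ u)).
Qed.

(** * Cycles and the extremal graphs *)

(** With degrees at most 2 and connectedness, no edge leaves the cycle. The right-hand side does not
    mention [c], so any two cycles coincide. *)
Lemma deg2_cycle_edges (G : sgraph) (c : seq G) : connected G ->
    (forall x : G, #|nb setT x| <= 2) -> 2 < size c -> ucycle (@adj G) c ->
  [set [set x; next c x] | x in c] =
  [set [set p.1; p.2] | p in [set p : G * G | adj p.1 p.2]].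
Proof.
move=> cG h2 hs uc; have /andP[cc ud] := uc.
have nbE x : x \in c -> nb setT x = [set next c x; prev c x].
  move=> xc; have [ne a1 a2] := cycle_nb hs uc xc.
  apply/esym/eqP; rewrite eqEcard cards2 ne h2 andbT.
  by apply/subsetP => y /set2P[]->; rewrite in_nb inE.
have step x y : adj x y -> x \in c -> y \in c.
  move=> axy xc; have : y \in nb setT x by rewrite in_nb inE.
  by rewrite nbE // => /set2P[]->; rewrite ?mem_next ?mem_prev.
have [x0 x0c] : exists x, x \in c by case: (c) hs => // x s _; exists x; rewrite mem_head.
have all_c x : x \in c.
  rewrite -(@closed_connect _ (@adj G) (mem c) _ x0 x) // => a b ab.
  by apply/idP/idP; apply: step; rewrite // adj_sym.
apply/setP => s; apply/imsetP/imsetP => [[x xc ->]|[[x y]]].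
  by exists (x, next c x); rewrite // inE; case: (cycle_nb hs uc xc).
rewrite inE /= => axy ->; have : y \in nb setT x by rewrite in_nb inE.
rewrite nbE // => /set2P[]->; first by exists x.
by exists (prev c x); rewrite // next_prev // setUC.
Qed.

Definition cycle_rel n (i j : nat) := (j == i.+1 %% n) || (i == j.+1 %% n).

Section CycleGraph.
Variable m : nat.
Let n := m.+3.

Definition cycle_adj : rel 'I_n := fun i j => cycle_rel n i j.

Lemma cycle_adj_sym : symmetric cycle_adj.
Proof. by move=> i j; rewrite /cycle_adj /cycle_rel orbC. Qed.

Lemma cycle_adj_irr : irreflexive cycle_adj.
Proof.
move=> i; rewrite /cycle_adj /cycle_rel orbb; apply/negbTE/eqP.
have := ltn_ord i; rewrite leq_eqVlt => /predU1P[e|h].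
  by rewrite e modnn => e0; rewrite e0 in e.
by rewrite modn_small //; lia.
Qed.

Definition cycle_graph := SGraph cycle_adj_sym cycle_adj_irr.

Lemma adj_cycleE (i j : cycle_graph) : adj i j = (ordS i == j) || (ordS j == i).
Proof. by rewrite /= /cycle_adj /cycle_rel -!val_eqE /= eq_sym [X in _ || X]eq_sym. Qed.

Lemma cycle_graph_connected : connected cycle_graph.
Proof.
have sym := sym_connect_sym cycle_adj_sym.
have from0 k (hk : k < n) : connect (@adj cycle_graph) ord0 (Ordinal hk).
  elim: k hk => [|k IH] hk; first by rewrite (_ : Ordinal hk = ord0) //; apply: val_inj.
  apply: connect_trans (IH (ltnW hk)) _; apply: connect1.
  by rewrite adj_cycleE -val_eqE /= modn_small ?eqxx.
move=> [i hi] [j hj]; apply: connect_trans (from0 j hj).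
by rewrite sym.
Qed.

Lemma cycle_graph_unicyclic : unicyclic cycle_graph.
Proof.
split; first exact: cycle_graph_connected.
have Sinj : injective (@ordS n) by apply: can_inj (@ordSK n).
pose c : seq cycle_graph := orbit (@ordS n) ord0.
have uc : ucycle (@adj cycle_graph) c.
  rewrite /ucycle orbit_uniq andbT; have := cycle_orbit Sinj ord0.
  by apply: sub_cycle => i j /eqP <-; rewrite adj_cycleE eqxx.
have hs : 2 < size c.
  have s3 : {subset [:: ord0; ordS ord0; ordS (ordS ord0)] <= c}.
    move=> i; rewrite /c -fconnect_orbit !inE => /or3P[]/eqP->.
    - exact: connect0.
    - exact: fconnect1.
    - exact: (fconnect_iter (@ordS n) 2).
  by apply: leq_trans (uniq_leq_size _ s3); rewrite //= !inE -!val_eqE /= !modn_small.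
have deg2 (x : cycle_graph) : #|nb setT x| <= 2.
  apply: leq_trans (_ : #|[set ordS x; ord_pred x]| <= 2); last first.
    by rewrite cards2; case: (_ != _).
  apply: subset_leq_card; apply/subsetP => y; rewrite in_nb inE adj_cycleE /=.
  by case/orP=> /eqP e; rewrite !inE -e ?ordSK eqxx ?orbT.
exists [set [set x; next c x] | x in c]; split; first by exists c.
move=> _ [d [hd ud ->]].
by rewrite !deg2_cycle_edges //; apply: cycle_graph_connected.
Qed.

End CycleGraph.

(** * Vertex sets as bit sequences, so that small cycles are settled by evaluation *)

Fixpoint bitseqs n : seq bitseq :=
  if n is p.+1 then map (cons true) (bitseqs p) ++ map (cons false) (bitseqs p)
  else [:: [::]].

Lemma mem_bitseqs n s : (s \in bitseqs n) = (size s == n).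
Proof.
elim: n s => [|n IH] s /=; first by rewrite inE size_eq0.
rewrite mem_cat; apply/orP/idP => [[]/mapP[t + ->]|].
- by rewrite IH.
- by rewrite IH.
by case: s => [|[] s] //= hs; [left|right]; apply: map_f; rewrite IH.
Qed.

Lemma uniq_bitseqs n : uniq (bitseqs n).
Proof.
elim: n => //= n IH; rewrite cat_uniq !map_inj_uniq ?IH; try by move=> ? ? [].
by rewrite andbT; apply/hasPn => _ /mapP[t _ ->]; apply/mapP => -[].
Qed.

Section Compute.
Variables (n : nat) (r : rel nat).
Hypotheses (rC : symmetric (fun i j : 'I_n => r i j))
  (rxx : irreflexive (fun i j : 'I_n => r i j)).
Let G := SGraph rC rxx.

Definition decode (s : bitseq) : {set G} := [set i : 'I_n | nth false s i].

Definition sub_bits (s a : bitseq) :=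
  all (fun i => nth false s i ==> nth false a i) (iota 0 n).
Definition indep_bits (s : bitseq) := all (fun i => nth false s i ==>
  all (fun j => nth false s j ==> ~~ r i j) (iota 0 n)) (iota 0 n).
Definition dominating_bits (s a : bitseq) := all (fun i =>
  nth false a i && ~~ nth false s i ==>
  has (fun j => nth false s j && r i j) (iota 0 n)) (iota 0 n).
Definition mis_bits (a s : bitseq) :=
  [&& sub_bits s a, indep_bits s & dominating_bits s a].

Lemma all_iota_ord (p : pred nat) : all p (iota 0 n) = [forall i : 'I_n, p i].
Proof.
apply/allP/forallP => [h i|h i]; first by apply: h; rewrite mem_iota ltn_ord.
by rewrite mem_iota => hi; apply: (h (Ordinal hi)).
Qed.

Lemma has_iota_ord (p : pred nat) : has p (iota 0 n) = [exists i : 'I_n, p i].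
Proof.
apply/hasP/existsP => [[i + hi]|[i hi]]; last by exists (val i); rewrite // mem_iota ltn_ord.
by rewrite mem_iota => hn; exists (Ordinal hn).
Qed.

Lemma in_decode s (i : 'I_n) : (i \in decode s) = nth false s i.
Proof. by rewrite inE. Qed.

Lemma sub_decode s a : (decode s \subset decode a) = sub_bits s a.
Proof.
rewrite /sub_bits all_iota_ord; apply/subsetP/forallP => h i.
  by apply/implyP; rewrite -!in_decode; apply: h.
by rewrite !in_decode => hi; have /implyP := h i; apply.
Qed.

Lemma independent_decode s : independent (decode s) = indep_bits s.
Proof.
rewrite /indep_bits all_iota_ord /independent; apply: eq_forallb => i /=.
rewrite in_decode all_iota_ord; congr (_ ==> _); apply: eq_forallb => j.
by rewrite in_decode.
Qed.

Lemma mises_decode s a : (decode s \in mises (decode a)) = mis_bits a s.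
Proof.
rewrite inE sub_decode independent_decode /mis_bits; congr [&& _, _ & _].
rewrite /dominating_bits all_iota_ord; apply: eq_forallb => i.
rewrite in_setD !in_decode andbC has_iota_ord; congr (_ ==> _).
by apply: eq_existsb => j; rewrite in_decode.
Qed.

Lemma decode_surj (S : {set G}) : exists2 s, size s = n & S = decode s.
Proof.
exists [seq i \in S | i <- enum 'I_n]; first by rewrite size_map size_enum_ord.
apply/setP => i; rewrite in_decode (nth_map i) ?size_enum_ord ?ltn_ord //.
by rewrite nth_ord_enum.
Qed.

Lemma decode_inj s t : size s = n -> size t = n -> decode s = decode t -> s = t.
Proof.
move=> hs ht e; apply: (@eq_from_nth _ false) => [|i]; first by rewrite hs.
rewrite hs => hi; have := congr1 (fun S : {set G} => Ordinal hi \in S) e.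
by rewrite !in_decode.
Qed.

Lemma card_decode s : size s = n -> #|decode s| = count id s.
Proof.
move=> hs; rewrite -sum1_count (big_nth false) hs big_mkord -sum1_card.
by apply: eq_bigl => i; rewrite in_decode.
Qed.

Lemma misA_decode a : misA (decode a) = count (mis_bits a) (bitseqs n).
Proof.
rewrite -size_filter -(size_map decode) -(card_uniqP _); last first.
  rewrite map_inj_in_uniq ?filter_uniq ?uniq_bitseqs // => s t.
  rewrite !mem_filter !mem_bitseqs => /andP[_ /eqP hs] /andP[_ /eqP ht].
  exact: decode_inj.
apply: eq_card => S; apply/idP/mapP => [|[s + ->]]; last first.
  by rewrite mem_filter -mises_decode => /andP[].
have [s hs ->] := decode_surj S; rewrite mises_decode => h.
by exists s; rewrite // mem_filter h mem_bitseqs hs /=.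
Qed.

Lemma alpha_decode a k :
    all (fun s => sub_bits s a && indep_bits s ==> (count id s <= k)) (bitseqs n) ->
    has (fun s => [&& sub_bits s a, indep_bits s & count id s == k]) (bitseqs n) ->
  alpha (decode a) = k.
Proof.
move=> /allP ub /hasP[s]; rewrite mem_bitseqs => /eqP hs /and3P[s1 s2 /eqP s3].
apply/eqP; rewrite eqn_leq; apply/andP; split; last first.
  by rewrite -s3 -card_decode // leq_alpha ?sub_decode ?independent_decode.
have [S [+ + <-]] := alpha_witness (decode a); have [t ht ->] := decode_surj S.
rewrite sub_decode independent_decode card_decode // => t1 t2.
by have := ub t; rewrite mem_bitseqs ht eqxx t1 t2; apply.
Qed.

End Compute.

(** [A0], [A1], [A2] are the masks of G, G - 0 and G - N[0]; the last omits 0, 1 and n - 1. *)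
Lemma realizable_cycle m al al' a b c :
    let n := m.+3 in let r := cycle_rel n in
    let A0 := nseq n true in let A1 := false :: nseq n.-1 true in
    let A2 := [:: false, false & rcons (nseq m true) false] in
    let alpha_is A k :=
      all (fun s => sub_bits n s A && indep_bits n r s ==> (count id s <= k)) (bitseqs n) &&
      has (fun s => [&& sub_bits n s A, indep_bits n r s & count id s == k]) (bitseqs n) in
    alpha_is A0 al -> alpha_is A1 al' ->
    count (mis_bits n r A0) (bitseqs n) = a ->
    count (mis_bits n r A1) (bitseqs n) = b ->
    count (mis_bits n r A2) (bitseqs n) = c ->
  realizable n al al' a b c.
Proof.
move=> n r A0 A1 A2 alpha_is /andP[h1 h2] /andP[h3 h4] <- <- <-.
pose D s : {set cycle_graph m} :=
  @decode n r (@cycle_adj_sym m) (@cycle_adj_irr m) s.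
exists (cycle_graph m), ord0.
have e0 : setT = D A0.
  by apply/setP => i; rewrite in_decode inE nth_nseq ltn_ord.
have e1 : setT :\ (ord0 : cycle_graph m) = D A1.
  apply/setP => -[[|i] hi]; rewrite in_decode in_setD1 in_setT -val_eqE //.
  by rewrite [RHS](nth_nseq false m.+2 true i) -ltnS hi.
have e2 : setT :\: clN [set (ord0 : cycle_graph m)] = D A2.
  apply/setP => i; rewrite in_decode in_setD in_clN1 in_setT andbT /=.
  rewrite /cycle_adj /cycle_rel -val_eqE /= (modn_small (_ : 1 < m.+3)) //.
  case: i => [[|[|i]] hi] //=.
  rewrite nth_rcons size_nseq nth_nseq.
  have [him|him] := ltnP i m; first by rewrite modn_small.
  have -> : i = m by move: hi; rewrite /n; lia.
  by rewrite eqxx modnn.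
split.
- exact: cycle_graph_unicyclic.
- by rewrite card_ord.
- by rewrite e1 e0; split; apply: alpha_decode.
- by rewrite e1 e2 e0; split; apply: misA_decode.
Qed.

(** * Extremal families *)

Lemma realizable_C3 : realizable 3 1 1 3 2 1.
Proof. by apply: (@realizable_cycle 0); vm_compute. Qed.

Lemma realizable_C4 : realizable 4 2 2 2 2 1.
Proof. by apply: (@realizable_cycle 1); vm_compute. Qed.

Lemma realizable_C5 : realizable 5 2 2 5 3 2.
Proof. by apply: (@realizable_cycle 2); vm_compute. Qed.

Lemma realizable_C7 : realizable 7 3 3 7 5 3.
Proof. by apply: (@realizable_cycle 4); vm_compute. Qed.

(** The triple (3, 2, 1) satisfies a = b + c, so it is fixed by [realizable_keep]. *)
Lemma realizable_triangle k : realizable k.+3 k.+1 k.+1 3 2 1.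
Proof.
elim: k => [|k IH]; first exact: realizable_C3.
exact: realizable_keep IH.
Qed.

(** One more path vertex carrying its own leaf: a Fibonacci step on (a, b). *)
Lemma realizable_path2 n al a b c : realizable n al al a b c ->
  realizable n.+2 al.+1 al.+1 (a + b) a b.
Proof. by move=> /realizable_move/realizable_keep. Qed.

(** The path has k + 1 vertices, and its last one carries [m] extra leaves, which raise alpha but
    not [tau]. *)
Lemma realizable_4cycle k m :
  realizable (k.*2 + m + 6) (k + m + 3) (k + m + 3)
    (2 * fib k.+3) (2 * fib k.+2) (2 * fib k.+1).
Proof.
elim: m => [|m IH]; last first.
  by have := realizable_keep IH; rewrite -mulnDr -fibSS !addnS.
elim: k => [|k IH]; first exact: realizable_path2 realizable_C4.
have := realizable_path2 IH; rewrite -mulnDr -fibSS.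
by rewrite doubleS !addn0 !addSn.
Qed.

(** C_7 starts at [odd_bound 4] and [odd_bound 3], from where the recurrence is exact. Extending C_5
    would give 5 + 3 = 8 instead of 7. *)
Lemma realizable_7cycle k :
  exists c, realizable (k.*2 + 7) (k + 3) (k + 3) (odd_bound k.+4) (odd_bound k.+3) c.
Proof.
elim: k => [|k [c IH]]; first by exists 3; apply: realizable_C7.
exists (odd_bound k.+3); have := realizable_path2 IH.
by rewrite -odd_bound_rec doubleS !addSn.
Qed.

Lemma realizable_mis n al al' a b c : realizable n al al' a b c ->
  exists G : sgraph, [/\ unicyclic G, #|G| = n, indep_num G = al & mis G = a].
Proof.
by move=> [G [u [uG nG [alG _] [aG _ _]]]]; exists G; rewrite alphaT misT.
Qed.

Lemma mis_bound_sharp n a b : 3 <= n -> mis_bound n a = Some b ->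
  exists G : sgraph, [/\ unicyclic G, #|G| = n, indep_num G = a & mis G = b].
Proof.
move=> n3; rewrite /mis_bound; case: ifP => [/andP[/eqP-> /eqP->] [<-]|_].
  exact: realizable_mis realizable_C4.
case: ifP => [/andP[/eqP-> _] [<-]|_].
  have := realizable_mis (realizable_triangle (n - 3)).
  by rewrite (_ : (n - 3).+3 = n) 1?(_ : (n - 3).+1 = n - 2) //; lia.
case: ifP => [h [<-]|_].
  (* In this family n - alpha = k + 3 and n = 2(n - alpha) + m. *)
  have := realizable_mis (realizable_4cycle (n - a - 3) (n - (n - a).*2)).
  set n' := _ + 6; set a' := _ + 3.
  have -> : n' = n by rewrite /n'; lia.
  have -> : a' = a by rewrite /a'; lia.
  by rewrite (_ : (n - a - 3).+3 = n - a) //; lia.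
case: ifP => // h [<-].
have [n5|n7] : n = 5 \/ 7 <= n by lia.
  have -> : a = 2 by lia.
  by rewrite n5; apply: realizable_mis realizable_C5.
have [c] := realizable_7cycle (n - a - 4) => /realizable_mis.
rewrite (_ : _ + 7 = n); last by lia.
rewrite (_ : _ + 3 = a); last by lia.
by rewrite (_ : (n - a - 4).+4 = n - a) //; lia.
Qed.

Theorem theorem2 :
  (forall G : sgraph, unicyclic G -> 3 <= #|G| ->
     exists2 b : nat, mis_bound #|G| (indep_num G) = Some b & b <= mis G) /\
  (forall n a b : nat, 3 <= n -> mis_bound n a = Some b ->
     exists G : sgraph,
       [/\ unicyclic G, #|G| = n, indep_num G = a & mis G = b]).
Proof. by split; [apply: unicyclic_mis_bound|apply: mis_bound_sharp]. Qed.
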